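(* Any planar 3-tree $G$ with $n$ vertices admits a path cover of size at most $\lfloor 5n/8 \rfloor$.
   Context: A planar 3-tree (also known as an Apollonian network) is a graph that can be constructed from the triangle $K_3$ and a sequence of stacking operations; $K_3$ itself is counted as a planar 3-tree. A stacking operation selects an interior triangular face $abc$ of the current plane graph, adds a new vertex $v$ inside this face, and introduces the edges $va$, $vb$, $vc$; the face $abc$ is thereby replaced by the three faces $vab$, $vac$, $vbc$. A path cover of a graph is a collection of edge-disjoint simple paths of the graph such that every edge of the graph is contained in exactly one of the paths. The size of a path cover is the number of paths it contains.
   Formalization: The claim is proved for n at least 4: the triangle K_3 is excluded, since floor(5*3/8) = 1 but its three edges cannot be covered by a single simple path. *)

(* Defs.v *)
From mathcomp Require Import all_boot.

Set Implicit Arguments.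
Unset Strict Implicit.
Unset Printing Implicit Defensive.

Record sgraph := SGraph {
  vertex :> finType;
  adj : rel vertex;
  adj_sym : symmetric adj;
  adj_irr : irreflexive adj }.

(* [stacked V E F]: a plane graph with vertex set [V], edge set [E] and set
   of interior faces [F] arises from a triangle by stacking operations.  Edges
   and interior faces are represented by their vertex sets.  For faces this
   loses nothing: every face created by a stacking contains the new vertex, so
   distinct interior faces have distinct vertex sets, and the outer face, whose
   vertex set is that of the initial interior face, is never recorded. *)
Inductive stacked (T : finType) :
    {set T} -> {set {set T}} -> {set {set T}} -> Prop :=
| Stacked_K3 (a b c : T) :
    uniq [:: a; b; c] ->
    stacked [set a; b; c]
            [set [set a; b]; [set a; c]; [set b; c]]
            [set [set a; b; c]]
| Stacked_step (V : {set T}) (E F : {set {set T}}) (a b c v : T) :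
    stacked V E F ->
    [set a; b; c] \in F ->
    v \notin V ->
    stacked (v |: V)
            (E :|: [set [set v; a]; [set v; b]; [set v; c]])
            ((F :\ [set a; b; c]) :|:
               [set [set v; a; b]; [set v; a; c]; [set v; b; c]]).

Definition planar_3tree (G : sgraph) : Prop :=
  exists E F : {set {set G}},
    stacked [set: G] E F /\
    forall x y : G, adj x y = ([set x; y] \in E).

Definition simple_path (G : sgraph) (p : seq G) : bool :=
  [&& p != [::], sorted (@adj G) p & uniq p].

Definition path_edges (G : sgraph) (p : seq G) : seq {set G} :=
  [seq [set xy.1; xy.2] | xy <- zip p (behead p)].

(* Counting over the list [P] makes the paths pairwise edge-disjoint: an edge
   lying on two entries of [P], even equal ones, would be counted twice.
   Pitfall: the triangle is a planar 3-tree on 3 vertices but has no path cover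
   of size [(5 * 3) %/ 8 = 1], since a simple path on 3 vertices has at most 2
   edges; the bound [(5 * n) %/ 8] can only hold from [n = 4] on. *)
Definition path_cover (G : sgraph) (P : seq (seq G)) : Prop :=
  all (@simple_path G) P /\
  forall x y : G, adj x y ->
    count (fun p => [set x; y] \in path_edges p) P = 1.

(* Main.v *)
Require Import Defs.
From mathcomp Require Import all_boot zify.

Set Implicit Arguments.
Unset Strict Implicit.
Unset Printing Implicit Defensive.

(** A planar 3-tree is a triangle together with a ternary tree of stackings, and
    the proof is an induction on this tree: a few vertices near its leaves are
    removed, the smaller planar 3-tree is covered by induction, and the removed
    vertices are put back.  It suffices that [m] vertices can be put back at the
    price of [r] new paths with [r <= 5 * m / 8].

    Two changes of an existing cover are free.  A path through an edge [xy] may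
    be rerouted from [x] to [y] through new vertices, which frees the edge [xy]
    for a new path ([pn_reroute]); and since some path ends at every vertex of
    odd degree, that path may be prolonged into the new vertices ([pn_extend]).
    With them one obtains a short list of insertions whose price depends on the
    parities of a few old degrees ([pn_leaf], [pn_pair], [pn_trio], [pn_chain],
    [pn_clip], [pn_clipped]); an insertion also changes these parities in a
    known way, so that insertions can be chained.  Typically an insertion that
    is too expensive makes a degree odd and the next one at that vertex is cheap.

    Call stub a tree of stackings that is empty, a single vertex, a clip (a
    vertex and two vertices stacked in two of its faces), or a clipped vertex (a
    vertex with a single clip in one of its faces, the clip being hung on an old
    vertex).  If the three subtrees of a stacked vertex [v] are stubs, then either
    the whole is again a stub, or all vertices or all but [v] can be removed at a
    price within [5 / 8] per vertex ([node_sorted], with one lemma [red_XYZ] for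
    each reducible combination of three stubs).  The parities help since [v] has
    the odd degree 3 when its faces are empty, and since each of the outer
    vertices [a], [b], [c] has odd degree either without [v] or with [v].

    So every tree that is not a stub shrinks ([tree_reduce]) and the stubs in a
    bare triangle are covered directly ([stub_bound]).  The bare triangle needs
    two paths, one eighth more than [5 * 3 / 8]; this eighth is recovered from the
    last reduction, which has it to spare unless some outer degree is odd, and
    all degrees of a bare triangle are even ([all_even]). *)

(** * Path decompositions of edge lists *)

(** Closes a linear goal after turning booleans and counts into atoms, which
    spares [lia] a case analysis on each of them. *)
Ltac count_lia :=
  repeat match goal with
  | |- context [nat_of_bool ?b] => move: (nat_of_bool b) => ?
  | |- context [count ?A ?s] => move: (count A s) => ?
  end; clear; lia.

Section PathNumber.
Variable T : finType.
Implicit Types (x y z a b : T) (p q s t : seq T) (P : seq (seq T)).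
Implicit Types (E : seq {set T}) (k : nat).

Definition edge x y : {set T} := [set x; y].

Lemma edgeC x y : edge x y = edge y x.
Proof. exact: setUC. Qed.

Lemma in_edge z x y : (z \in edge x y) = (z == x) || (z == y).
Proof. by rewrite !inE. Qed.

Lemma edge_inj a x y : edge a x = edge a y -> x = y.
Proof.
move=> eq_axy.
have: x \in edge a y by rewrite -eq_axy in_edge eqxx orbT.
have: y \in edge a x by rewrite eq_axy in_edge eqxx orbT.
by rewrite !in_edge => /orP[]/eqP-> // /orP[]/eqP.
Qed.

Definition links p := if p is x :: s then pairmap edge x s else [::].

Definition deg E x := count (fun e : {set T} => x \in e) E.

Definition fresh E x := all (fun e : {set T} => x \notin e) E.

Definition decomp P E :=
  all (fun p => (p != [::]) && uniq p) P && perm_eq (flatten (map links P)) E.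

(** Path number at most [k].  Edges form a list up to permutation rather than a
    set, so that freed and added edges can be moved around without any
    disjointness condition. *)
Definition pn E k := exists2 P, decomp P E & size P <= k.

Lemma links_cat p x q : links (p ++ x :: q) = links (rcons p x) ++ links (x :: q).
Proof. by case: p => [|y p] //=; rewrite -cats1 !pairmap_cat /= -catA. Qed.

Lemma links_rev p : perm_eq (links (rev p)) (links p).
Proof.
elim: p => [|x [|y s] IHs] //.
have -> : rev [:: x, y & s] = rev s ++ [:: y; x].
  by rewrite !rev_cons -!cats1 -catA.
rewrite links_cat -rev_cons /= perm_catC /= edgeC perm_cons; exact: IHs.
Qed.

Lemma links_ends s x y p1 p2 :
  perm_eq (links (p1 ++ x :: s ++ y :: p2))
    (links (rcons p1 x) ++ links (x :: rcons s y) ++ links (y :: p2)).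
Proof. by rewrite links_cat -cat_cons links_cat rcons_cons. Qed.

Lemma linksP x y p : edge x y \in links p ->
  exists p1 p2, p = p1 ++ x :: y :: p2 \/ p = p1 ++ y :: x :: p2.
Proof.
elim: p => [|z [|t p] IHp] //=; rewrite inE => /orP[/eqP eq_xy|/IHp].
  exists [::], p; have := set21 x y; have := set22 x y.
  rewrite -[[set x; y]]/(edge x y) eq_xy !in_edge => /orP[]/eqP y_zt /orP[]/eqP x_zt; subst.
  - have/(@edge_inj z)-> : edge z z = edge z t by [].
    by left.
  - by right.
  - by left.
  - have/(@edge_inj t)-> : edge t t = edge t z by rewrite (edgeC t z).
    by left.
by case=> p1 [p2 [->|->]]; exists (z :: p1), p2; [left|right].
Qed.

Lemma links_head a b p : uniq (a :: p) -> edge a b \in links (a :: p) ->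
  exists p', p = b :: p'.
Proof.
move=> ap_uniq /linksP[p1 [p2 [def_p|def_p]]].
  case: p1 def_p => [[->]|y p1 [_ def_p]]; first by exists p2.
  by move: ap_uniq; rewrite def_p /= mem_cat inE eqxx orbT.
case: p1 def_p => [[<- def_p]|y p1 [_ def_p]].
  by move: ap_uniq; rewrite def_p /= inE eqxx.
by move: ap_uniq; rewrite def_p /= mem_cat !inE eqxx !orbT.
Qed.

Lemma mem_links p x : 1 < size p -> x \in p -> has (fun e : {set T} => x \in e) (links p).
Proof.
elim: p => [|z [|t p] IHp] //= _; rewrite inE => /orP[/eqP->|x_tp].
  by rewrite in_edge eqxx.
case: p IHp x_tp => [|t' p] IHp; first by rewrite inE => /eqP->; rewrite in_edge eqxx orbT.
by move/(IHp isT)->; rewrite orbT.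
Qed.

(** Inner vertices of a path meet two of its edges. *)
Lemma odd_deg_links x p z : uniq (x :: p) ->
  odd (deg (links (x :: p)) z) = (z == x) (+) (z == last x p).
Proof.
elim: p x => [|y p IHp] x /=; first by rewrite addbb.
rewrite [deg _ _]/= oddD oddb -/(deg _ z).
rewrite inE negb_or -!andbA => /and3P[neq_xy _ yp_uniq].
have /= -> := IHp y yp_uniq; rewrite in_edge.
have: ~~ ((z == x) && (z == y)) by apply: contra neq_xy => /andP[/eqP<- /eqP<-].
by case: (z == x); case: (z == y); case: (z == _).
Qed.

Arguments links : simpl never.

Lemma deg_cat E1 E2 x : deg (E1 ++ E2) x = deg E1 x + deg E2 x.
Proof. exact: count_cat. Qed.

Lemma deg_perm E1 E2 x : perm_eq E1 E2 -> deg E1 x = deg E2 x.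
Proof. by move/permP; apply. Qed.

Lemma fresh_perm E1 E2 x : perm_eq E1 E2 -> fresh E1 x = fresh E2 x.
Proof. exact: perm_all. Qed.

Lemma deg_fresh E x : fresh E x -> deg E x = 0.
Proof.
by move=> fr_x; apply/eqP; rewrite -leqn0 leqNgt -has_count -all_predC.
Qed.

Lemma freshN E x : fresh E x = ~~ has (fun e : {set T} => x \in e) E.
Proof. by rewrite -all_predC. Qed.

Lemma fresh_cat E1 E2 x : fresh (E1 ++ E2) x = fresh E1 x && fresh E2 x.
Proof. exact: all_cat. Qed.

Lemma decomp_perm P Q E1 E2 :
  perm_eq P Q -> perm_eq E1 E2 -> decomp P E1 -> decomp Q E2.
Proof.
move=> eqPQ eqE /andP[okP eqPE]; rewrite /decomp -(perm_all _ eqPQ) okP /=.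
by rewrite -(permPr eqE) -(permPl (perm_flatten (perm_map links eqPQ))).
Qed.

Lemma pn_perm E1 E2 k : perm_eq E1 E2 -> pn E1 k -> pn E2 k.
Proof. by move=> eqE [P decP leP]; exists P => //; apply: decomp_perm decP. Qed.

Lemma pn_leq E k1 k2 : k1 <= k2 -> pn E k1 -> pn E k2.
Proof. by move=> le_k [P decP leP]; exists P => //; apply: leq_trans le_k. Qed.

Lemma decomp_cons p P E : decomp (p :: P) E =
  [&& p != [::], uniq p, all (fun p => (p != [::]) && uniq p) P &
      perm_eq (links p ++ flatten (map links P)) E].
Proof. by rewrite /decomp /= -!andbA. Qed.

Lemma pn_path p E k : uniq p -> pn E k -> pn (links p ++ E) k.+1.
Proof.
case: p => [|x p] p_uniq [P /andP[okP eqE] leP].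
  by exists P; rewrite ?(leqW leP) // /decomp okP.
by exists ((x :: p) :: P) => //; rewrite decomp_cons p_uniq okP /= perm_cat2l.
Qed.

(** The path through [xy] makes a detour through [s]; as [s] avoids all old
    vertices the path remains simple. *)
Lemma decomp_reroute x y s P E :
  decomp P (edge x y :: E) -> uniq s -> all (fresh (edge x y :: E)) s ->
  exists2 Q, decomp Q (links (x :: rcons s y) ++ E) & size Q = size P.
Proof.
move=> decP s_uniq s_fresh; have [/allP okP eqPE] := andP decP.
have/flattenP[_ /mapP[p Pp ->] p_xy]: edge x y \in flatten (map links P).
  by rewrite (perm_mem eqPE) mem_head.
have [p1 [p2 [p_uniq p_links]]]: exists p1 p2, uniq (p1 ++ x :: y :: p2)
    /\ perm_eq (links (p1 ++ x :: y :: p2)) (links p).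
  have [p1 [p2 [def_p|def_p]]] := linksP p_xy; have /andP[_] := okP p Pp.
    by exists p1, p2; rewrite -def_p.
  move=> p_uniq; exists (rev p2), (rev p1).
  have -> : rev p2 ++ x :: y :: rev p1 = rev p.
    by rewrite def_p rev_cat !rev_cons -!cats1 -!catA.
  by rewrite rev_uniq; split=> //; apply: links_rev.
have eqP' := perm_to_rem Pp; set P' := rem p P in eqP'.
exists ((p1 ++ x :: s ++ y :: p2) :: P'); last by rewrite (perm_size eqP').
have := decomp_perm eqP' (perm_refl _) decP.
rewrite !decomp_cons => /and4P[_ _ -> eqE].
apply/and4P; split=> //; first by case: (p1).
  have eq_s: perm_eq (p1 ++ x :: s ++ y :: p2) (s ++ p1 ++ x :: y :: p2).
    by apply/permP=> A; rewrite /= !count_cat /= !count_cat /=; count_lia.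
  rewrite (perm_uniq eq_s) cat_uniq s_uniq p_uniq andbT /=.
  apply/hasPn=> z z_p; apply/negP=> /(allP s_fresh).
  rewrite freshN -(perm_has _ eqE) has_cat -(perm_has _ p_links).
  by rewrite mem_links // size_cat /= !addnS.
have := perm_trans (perm_cat p_links (perm_refl _)) eqE.
move/permP=> {}eqE; apply/permP=> A.
have := eqE A; rewrite !count_cat (permP (links_ends s x y p1 p2)).
have := permP (links_ends [::] x y p1 p2) A; rewrite /= => ->.
rewrite !count_cat /=; count_lia.
Qed.

Lemma pn_reroute x y s E k :
  uniq s -> all (fresh (edge x y :: E)) s ->
  pn (edge x y :: E) k -> pn (links (x :: rcons s y) ++ E) k.
Proof.
move=> s_uniq s_fr [P decP leP].
by have [Q decQ szQ] := decomp_reroute decP s_uniq s_fr; exists Q; rewrite ?szQ.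
Qed.

(** Only path ends contribute to the parity of a degree. *)
Lemma odd_end P E a : decomp P E -> odd (deg E a) ->
  exists s Q, decomp ((a :: s) :: Q) E /\ size P = (size Q).+1.
Proof.
move=> decP; have [/allP okP eqPE] := andP decP.
rewrite -(deg_perm a eqPE) => odd_a.
have [p Pp odd_p]: exists2 p, p \in P & odd (deg (links p) a).
  apply/hasP; apply: contraTT odd_a; rewrite -all_predC.
  elim: (P) => //= p Q IHQ /andP[p_even /IHQ].
  by rewrite deg_cat oddD => /negbTE->; rewrite addbF.
have eqP' := perm_to_rem Pp; set P' := rem p P in eqP'.
have [s [as_uniq as_links]]: exists s, uniq (a :: s) /\ perm_eq (links (a :: s)) (links p).
  have /andP[] := okP p Pp; case: p odd_p {Pp eqP' P'} => [|x p] // + _ p_uniq.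
  rewrite odd_deg_links //; case: (eqVneq a x) => [->|neq_ax]; first by exists p.
  case/lastP: p p_uniq => [|p z] p_uniq; first by rewrite (negbTE neq_ax).
  rewrite last_rcons => /eqP->; exists (rev (x :: p)).
  by rewrite -(rev_rcons (x :: p)) rev_uniq; split=> //; apply: links_rev.
exists s, P'; rewrite (perm_size eqP'); split=> //.
have := decomp_perm eqP' (perm_refl _) decP.
rewrite !decomp_cons => /and4P[_ _ ->] /=.
have /= -> := as_uniq.
by rewrite -(permPl (perm_cat as_links (perm_refl _))).
Qed.

Lemma links_prepend a s t :
  perm_eq (links (rev t ++ a :: s)) (links (a :: t) ++ links (a :: s)).
Proof.
by rewrite links_cat perm_cat2r -rev_cons links_rev.
Qed.

Lemma uniq_prepend a s t E :
  uniq (a :: s) -> uniq t -> all (fresh E) t -> ~~ fresh E a ->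
  {subset links (a :: s) <= E} -> uniq (rev t ++ a :: s).
Proof.
move=> as_uniq t_uniq t_fr a_old sub_E.
rewrite cat_uniq rev_uniq t_uniq as_uniq andbT; apply/hasPn=> z z_as.
rewrite mem_rev; apply/negP=> /(allP t_fr); move: z_as.
case: (posnP (size s)) => [/size0nil->|s_gt0].
  by rewrite inE => /eqP->; apply/negP.
move=> /(mem_links (s_gt0 : 1 < size (a :: s))) /hasP[e /sub_E Ee z_e].
by rewrite freshN => /hasPn/(_ e Ee)/negP.
Qed.

Lemma odd_nfresh E a : odd (deg E a) -> ~~ fresh E a.
Proof. by apply: contraL => /deg_fresh->. Qed.

Lemma pn_extend a t E k :
  uniq t -> all (fresh E) t -> odd (deg E a) -> pn E k -> pn (links (a :: t) ++ E) k.
Proof.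
move=> t_uniq t_fr odd_a [P decP leP].
have [s [Q [decQ szP]]] := odd_end decP odd_a.
exists ((rev t ++ a :: s) :: Q); last by rewrite /= -szP.
move: decQ; rewrite !decomp_cons => /and4P[_ as_uniq -> eqE].
rewrite (uniq_prepend as_uniq t_uniq t_fr (odd_nfresh odd_a)) => [|e e_as].
  rewrite (permPl (perm_cat (links_prepend _ _ _) (perm_refl _))) -catA perm_cat2l eqE.
  by case: (rev t).
by rewrite -(perm_mem eqE) mem_cat e_as.
Qed.

(** An extension and a reroute may share a new vertex, here in [t] and in [s1] or
    [s2], only if they affect different paths.  A path that ends at [a] has just
    one edge at [a], so one of [ab] and [ad] lies on another path; which of the
    two cannot be chosen. *)
Lemma pn_fork a b d s1 s2 t E k :
  b != d -> uniq s1 -> uniq s2 -> uniq t ->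
  all (fresh [:: edge a b, edge a d & E]) (s1 ++ s2 ++ t) ->
  odd (deg [:: edge a b, edge a d & E] a) ->
  pn [:: edge a b, edge a d & E] k ->
     pn (links (a :: t) ++ links (a :: rcons s1 b) ++ edge a d :: E) k
  \/ pn (links (a :: t) ++ links (a :: rcons s2 d) ++ edge a b :: E) k.
Proof.
set E1 := [:: _, _ & E]; rewrite !all_cat => neq_bd s1_uniq s2_uniq t_uniq.
case/and3P=> s1_fr s2_fr t_fr odd_a [P decP leP].
have [r [Q [decQ szP]]] := odd_end decP odd_a; rewrite szP in leP.
wlog ar_b: b d s1 s2 s1_uniq s2_uniq @E1 neq_bd s1_fr s2_fr t_fr odd_a {decP} decQ /
    edge a b \notin links (a :: r).
  move=> IH; case: (boolP (edge a b \in links (a :: r))) => [ar_b|]; last exact: IH.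
  have eqE1: perm_eq E1 [:: edge a d, edge a b & E].
    by apply/permP=> A /=; count_lia.
  have eq_fr := eq_all (fun x => fresh_perm x eqE1).
  have [] := IH d b s2 s1; rewrite -?(deg_perm _ eqE1) -?eq_fr 1?eq_sym //.
  - exact: decomp_perm (perm_refl _) eqE1 decQ.
  - have /andP[/andP[/andP[_ ar_uniq] _] _] := decQ.
    apply: contra neq_bd => /(links_head ar_uniq)[r1 def_r].
    by have [r2] := links_head ar_uniq ar_b; rewrite def_r => -[->].
  - by right.
  - by left.
left; move: decQ; rewrite decomp_cons => /and4P[_ ar_uniq okQ eqE].
set EQ := flatten (map links Q) in eqE.
have EQ_b: edge a b \in EQ.
  by have := perm_mem eqE (edge a b); rewrite mem_cat (negbTE ar_b) mem_head.
have eqEQ := perm_to_rem EQ_b.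
have decQ: decomp Q (edge a b :: rem (edge a b) EQ) by rewrite /decomp okQ.
have s_frQ: all (fresh (edge a b :: rem (edge a b) EQ)) s1.
  apply: sub_all s1_fr => z; rewrite -(fresh_perm z eqE) fresh_cat => /andP[_].
  by rewrite (fresh_perm z eqEQ).
have [Q' decQ' szQ'] := decomp_reroute decQ s1_uniq s_frQ.
exists ((rev t ++ a :: r) :: Q'); last by rewrite /= szQ'.
rewrite decomp_cons; have [-> eqQ'] := andP decQ'.
rewrite (uniq_prepend ar_uniq t_uniq t_fr (odd_nfresh odd_a)) => [|e e_ar]; last first.
  by rewrite -(perm_mem eqE) mem_cat e_ar.
apply/and4P; split=> //; first by case: (rev t).
apply/permP=> A; have:= permP eqE A; have:= permP eqEQ A; have:= permP eqQ' A.
have:= permP (links_prepend a r t) A; rewrite /= !count_cat /= => -> ->.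
count_lia.
Qed.

Lemma fresh_cons e E x : fresh (e :: E) x = (x \notin e) && fresh E x.
Proof. by []. Qed.

Lemma fresh_nil x : fresh [::] x = true.
Proof. by []. Qed.

End PathNumber.

(** * Inserting vertices of degree three *)

Definition star (T : finType) (v a b c : T) : seq {set T} :=
  [:: edge v a; edge v b; edge v c].

(** A clip hung on [a] in the triangle [abd]: [w] is stacked in [abd], then [u]
    and [v] in the two new faces at the edge [wa].  The degrees of [b] and [d]
    keep their parity, that of [a] changes. *)
Definition clip_edges (T : finType) (a b d w u v : T) : seq {set T} :=
  star w a b d ++ star u w a b ++ star v w a d.

Ltac conj_hyps := repeat match goal with
  | H : is_true (_ && _) |- _ => case/andP: H => ? ? end.

Ltac conj_goal :=
  rewrite /links /star /clip_edges ?fresh_cat /=;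
  rewrite ?fresh_cons ?fresh_nil ?in_edge ?inE ?negb_or ?andbT;
  repeat (apply/andP; split); first [assumption | by rewrite eq_sym | idtac].

(** Rewrites the two orientations of an edge into one. *)
Ltac edge_norm := repeat match goal with |- context [edge ?x ?y] =>
  match goal with |- context [edge y x] => rewrite (edgeC y x) end end.

Ltac perm_edges :=
  let A := fresh "A" in
  apply/permP => A;
  try match goal with H : is_true (perm_eq _ _) |- _ => move: (permP H A) end;
  rewrite /links /star /clip_edges ?count_cat /= ?count_cat /=; edge_norm; count_lia.

Ltac sub_tac :=
  let e := fresh "e" in let H := fresh "H" in
  move=> e; rewrite !(mem_cat, inE) => H;
  repeat (case/orP: H => H); rewrite H ?orbT //.

Section Gadgets.
Variable T : finType.
Implicit Types (x y z a b : T) (p q s t : seq T) (P : seq (seq T)).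
Implicit Types (E : seq {set T}) (k : nat).

Definition tri E (a b c : T) :=
  [&& uniq [:: a; b; c], edge a b \in E, edge a c \in E & edge b c \in E].

Lemma tri_swap12 E a b c : tri E a b c = tri E b a c.
Proof.
by rewrite /tri /= !inE !negb_or (eq_sym b a) (edgeC b a) andbCA -!andbA; do !bool_congr.
Qed.

Lemma tri_swap23 E a b c : tri E a b c = tri E a c b.
Proof.
by rewrite /tri /= !inE !negb_or (eq_sym b c) (edgeC b c) -!andbA; do !bool_congr.
Qed.

Lemma triP E a b c : tri E a b c ->
  [/\ a != b, a != c, b != c &
   exists E0, perm_eq E [:: edge a b, edge a c, edge b c & E0]].
Proof.
case/and4P; rewrite /= !inE negb_or andbT => /andP[/andP[neq_ab neq_ac] neq_bc].
move=> E_ab E_ac E_bc; split=> //.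
have neq1: edge a c != edge a b by apply: contra neq_bc => /eqP/edge_inj->.
have neq2: edge b c != edge a b.
  by apply: contra neq_ac => /eqP; rewrite (edgeC a) => /edge_inj->.
have neq3: edge b c != edge a c.
  by apply: contra neq_ab => /eqP; rewrite !(edgeC _ c) => /edge_inj->.
have eq1 := perm_to_rem E_ab; move: E_ac E_bc.
rewrite !(perm_mem eq1) !(inE, negPf neq1, negPf neq2) /= => E_ac E_bc.
have eq2 := perm_to_rem E_ac; move: E_bc.
rewrite (perm_mem eq2) inE (negPf neq3) /= => /perm_to_rem eq3.
eexists; rewrite (permPl eq1) perm_cons (permPl eq2) perm_cons; exact: eq3.
Qed.

(** A path ending at an odd vertex [a] is extended to [v]; the path [b v c] is
    new. *)
Lemma pn_leaf E a b c v k : tri E a b c -> fresh E v ->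
  [|| odd (deg E a), odd (deg E b) | odd (deg E c)] ->
  pn E k -> pn (star v a b c ++ E) k.+1.
Proof.
have main x y z : tri E x y z -> fresh E v -> odd (deg E x) -> pn E k ->
    pn (star v x y z ++ E) k.+1.
  move=> triE fr_v odd_x pnE.
  have [neq_xy neq_xz neq_yz [E0 eqE]] := triP triE.
  have fr := fr_v; rewrite (fresh_perm _ eqE) !fresh_cons !in_edge !negb_or in fr; conj_hyps.
  apply: pn_perm (pn_path (p := [:: y; v; z]) _ (pn_extend (a := x) (t := [:: v]) _ _ _ pnE)) => //.
  - by perm_edges.
  - by conj_goal.
  - by conj_goal.
move=> triE fr_v /or3P[] odd_x pnE.
- exact: main odd_x pnE.
- by apply: pn_perm (main b a c _ _ odd_x pnE); rewrite 1?tri_swap12 //; perm_edges.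
- by apply: pn_perm (main c a b _ _ odd_x pnE); rewrite 1?tri_swap12 1?tri_swap23 //; perm_edges.
Qed.

Lemma fresh_tri E a b c x : tri E a b c -> fresh E x ->
  [&& x != a, x != b & x != c].
Proof.
case/triP=> _ _ _ [E0 eqE]; rewrite (fresh_perm _ eqE) !fresh_cons !in_edge !negb_or.
by case/and3P=> /andP[-> ->] /andP[_ ->].
Qed.

(** [v] and [w] are stacked in the faces [abc] and [abd], which share [ab].  The
    path ending at [c] goes on to [v], the edge [ad] is replaced by [a w d], and
    [d a v b w] is the new path. *)
Lemma pn_pair1 E a b c d v w k :
  tri E a b c -> tri E a b d -> c != d -> fresh E v -> fresh E w -> v != w ->
  odd (deg E c) -> pn E k -> pn (star v a b c ++ star w a b d ++ E) k.+1.
Proof.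
move=> tri_c tri_d neq_cd fr_v fr_w neq_vw odd_c pnE.
have [neq_ab neq_ad neq_bd [E0 eqE]] := triP tri_d.
have := fresh_tri tri_c fr_v; have := fresh_tri tri_c fr_w => *.
have [_ neq_ac neq_bc _] := triP tri_c.
have frv := fr_v; have frw := fr_w.
rewrite !(fresh_perm _ eqE) !fresh_cons !in_edge !negb_or in frv frw; conj_hyps.
apply: pn_perm (pn_path (p := [:: d; a; v; b; w]) _ (pn_reroute (x := a) (y := d)
  (s := [:: w]) (E := links [:: c; v] ++ [:: edge a b, edge b d & E0]) _ _
  (pn_perm _ (pn_extend (a := c) (t := [:: v]) _ _ _ pnE)))) => //.
- by perm_edges.
- by conj_goal.
- by conj_goal.
- by perm_edges.
- by conj_goal.
Qed.

Lemma pn_pair E a b c d v w k :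
  tri E a b c -> tri E a b d -> c != d -> fresh E v -> fresh E w -> v != w ->
  pn E k -> pn (star v a b c ++ star w a b d ++ E) (k + 1 + ~~ (odd (deg E c) || odd (deg E d))).
Proof.
move=> tri_c tri_d neq_cd fr_v fr_w neq_vw pnE.
case: (boolP (odd (deg E c))) => [odd_c|_]; first by rewrite addn0 addn1; apply: pn_pair1.
case: (boolP (odd (deg E d))) => [odd_d|_].
  rewrite addn0 addn1; apply: pn_perm (pn_pair1 tri_d tri_c _ fr_w fr_v _ odd_d pnE).
  - by perm_edges.
  - by rewrite eq_sym.
  - by rewrite eq_sym.
have := fresh_tri tri_c fr_v; have := fresh_tri tri_c fr_w.
have := fresh_tri tri_d fr_v; have := fresh_tri tri_d fr_w => *.
have [neq_ab neq_ad neq_bd _] := triP tri_d; have [_ neq_ac neq_bc _] := triP tri_c.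
conj_hyps; rewrite !addn1.
apply: pn_perm (pn_path (p := [:: c; v; a; w; d]) _ (pn_path (p := [:: v; b; w]) _ pnE)).
- by perm_edges.
- by conj_goal.
- by conj_goal.
Qed.

(** [a] lies in the triangle [bcd], and each of the three faces around it receives
    a vertex.  A path ending at [a] goes on to [u], the edges [ad] and [ac] make
    detours through [v] and [w], and a single new path takes the remaining and
    the freed edges. *)
Lemma pn_trio E a b c d u v w k :
  tri E a b c -> tri E a b d -> tri E a c d ->
  fresh E u -> fresh E v -> fresh E w -> uniq [:: u; v; w] ->
  odd (deg E a) -> pn E k ->
  pn (star u a b c ++ star v a b d ++ star w a c d ++ E) k.+1.
Proof.
move=> tri_bc tri_bd tri_cd fr_u fr_v fr_w; rewrite /= !inE negb_or andbT.
move=> /andP[/andP[neq_uv neq_uw] neq_vw] odd_a pnE.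
have [neq_ab neq_ac neq_bc _] := triP tri_bc; have [_ neq_ad neq_bd _] := triP tri_bd.
have [_ _ neq_cd [E0 eqE]] := triP tri_cd.
have := fresh_tri tri_bc fr_u; have := fresh_tri tri_bc fr_v; have := fresh_tri tri_bc fr_w.
have fru := fr_u; have frv := fr_v; have frw := fr_w => *.
rewrite !(fresh_perm _ eqE) !fresh_cons !in_edge !negb_or in fru frv frw; conj_hyps.
apply: pn_perm (pn_path (p := [:: v; b; u; c; a; d; w]) _ (pn_reroute (x := a) (y := c)
  (s := [:: w]) (E := links [:: a; v; d] ++ links [:: a; u] ++ [:: edge c d & E0]) _ _
  (pn_perm _ (pn_reroute (x := a) (y := d)
  (s := [:: v]) (E := links [:: a; u] ++ [:: edge a c, edge c d & E0]) _ _
  (pn_perm _ (pn_extend (a := a) (t := [:: u]) _ _ _ pnE)))))) => //.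
- by perm_edges.
- by conj_goal.
- by conj_goal.
- by perm_edges.
- by conj_goal.
- by perm_edges.
- by conj_goal.
Qed.

(** [v] is stacked in [abc], then [w] in [vab].  The detours [a w b] and [b v c]
    free [ab] and [bc] for the new path [c b a v w]. *)
Lemma pn_chain E a b c v w k :
  tri E a b c -> fresh E v -> fresh E w -> v != w ->
  pn E k -> pn (star w v a b ++ star v a b c ++ E) k.+1.
Proof.
move=> triE fr_v fr_w neq_vw pnE.
have [neq_ab neq_ac neq_bc [E0 eqE]] := triP triE.
have frv := fr_v; have frw := fr_w => *.
rewrite !(fresh_perm _ eqE) !fresh_cons !in_edge !negb_or in frv frw; conj_hyps.
apply: pn_perm (pn_path (p := [:: c; b; a; v; w]) _ (pn_reroute (x := b) (y := c)
  (s := [:: v]) (E := links [:: a; w; b] ++ [:: edge a c & E0]) _ _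
  (pn_perm _ (pn_reroute (x := a) (y := b) (s := [:: w])
     (E := [:: edge a c, edge b c & E0]) _ _ (pn_perm eqE pnE))))) => //.
- by perm_edges.
- by conj_goal.
- by conj_goal.
- by perm_edges.
- by conj_goal.
Qed.

(** A clip costs one path if it hangs on a vertex of odd degree and two paths
    otherwise.  In the odd case three paths have to meet at [w], which has degree
    5: the extension of the path ending at [a], a detour and the new
    path.  The first two must come from different paths, hence [pn_fork]. *)
Lemma pn_clip E a b d w u v k :
  tri E a b d -> fresh E w -> fresh E u -> fresh E v -> uniq [:: w; u; v] ->
  pn E k -> pn (clip_edges a b d w u v ++ E) (k + 1 + ~~ odd (deg E a)).
Proof.
move=> triE fr_w fr_u fr_v; rewrite /= !inE negb_or andbT.
move=> /andP[/andP[neq_wu neq_wv] neq_uv] pnE.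
have [neq_ab neq_ad neq_bd [E0 eqE]] := triP triE.
have fru := fr_u; have frv := fr_v; have frw := fr_w => *.
rewrite !(fresh_perm _ eqE) !fresh_cons !in_edge !negb_or in fru frv frw; conj_hyps.
case: (boolP (odd (deg E a))) => [odd_a|_]; last first.
  rewrite !addn1.
  apply: pn_perm (pn_path (p := [:: u; b; d; v; a; w]) _ (pn_path (p := [:: a; u; w; v]) _
    (pn_reroute (x := b) (y := d) (s := [:: w])
     (E := [:: edge a b, edge a d & E0]) _ _ (pn_perm _ pnE)))) => //.
  - by perm_edges.
  - by conj_goal.
  - by conj_goal.
  - by conj_goal.
  - by perm_edges.
rewrite addn1 addn0.
have [||||||pn1|pn1] :=
  @pn_fork T a b d [:: u; w] [:: v; w] [:: w] (edge b d :: E0) k neq_bd.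
- by conj_goal.
- by conj_goal.
- by [].
- by conj_goal.
- by rewrite -(deg_perm _ eqE).
- exact: pn_perm eqE pnE.
- apply: pn_perm (pn_path (p := [:: u; b; a; d; w; v]) _ (pn_reroute (x := a) (y := d)
  (s := [:: v]) (E := links [:: a; w] ++ links [:: a; u; w; b] ++ [:: edge b d & E0]) _ _
  (pn_perm _ pn1))) => //.
  + by perm_edges.
  + by conj_goal.
  + by conj_goal.
  + by perm_edges.
- apply: pn_perm (pn_path (p := [:: v; d; a; b; w; u]) _ (pn_reroute (x := a) (y := b)
  (s := [:: u]) (E := links [:: a; w] ++ links [:: a; v; w; d] ++ [:: edge b d & E0]) _ _
  (pn_perm _ pn1))) => //.
  + by perm_edges.
  + by conj_goal.
  + by conj_goal.
  + by perm_edges.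
Qed.

(** [y] is stacked in [abd] and a clip on [a] in the face [yab].  Here the third
    vertex [d] of the outer triangle, away from the clip, has to be odd: a path
    ending there goes on to [y], and the detour [a w b] frees [ab]. *)
Lemma pn_clipped E a b d y w u v k :
  tri E a b d -> fresh E y -> fresh E w -> fresh E u -> fresh E v ->
  uniq [:: y; w; u; v] -> odd (deg E d) ->
  pn E k -> pn (star y a b d ++ clip_edges a b y w u v ++ E) k.+2.
Proof.
move=> triE fr_y fr_w fr_u fr_v; rewrite /= !inE !negb_or andbT => uniqX odd_d pnE.
have [neq_ab neq_ad neq_bd [E0 eqE]] := triP triE.
have fru := fr_u; have frv := fr_v; have frw := fr_w; have fry := fr_y => *.
rewrite !(fresh_perm _ eqE) !fresh_cons !in_edge !negb_or in fru frv frw fry; conj_hyps.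
apply: pn_perm (pn_path (p := [:: u; b; y; a; v; w]) _ (pn_path (p := [:: b; a; u; w; y; v]) _
  (pn_reroute (x := a) (y := b) (s := [:: w])
     (E := links [:: d; y] ++ [:: edge a d, edge b d & E0]) _ _
  (pn_perm _ (pn_extend (a := d) (t := [:: y]) _ _ _ pnE))))) => //.
- by perm_edges.
- by conj_goal.
- by conj_goal.
- by conj_goal.
- by perm_edges.
- by conj_goal.
Qed.

(** * Sequences of insertions *)

Definition par E (x : T) := odd (deg E x).

Lemma par_cat E1 E2 x : par (E1 ++ E2) x = par E1 x (+) par E2 x.
Proof. by rewrite /par deg_cat oddD. Qed.

Lemma par_star v a b c x : x != v ->
  par (star v a b c) x = (x == a) (+) (x == b) (+) (x == c).
Proof.
move=> /negPf neq_xv; rewrite /par /deg /= !in_edge neq_xv /=.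
by case: (x == a); case: (x == b); case: (x == c).
Qed.

Lemma par_clip_edges a b d w u v x : x \notin [:: w; u; v] ->
  par (clip_edges a b d w u v) x = (x == a).
Proof.
rewrite !inE !negb_or => /and3P[xw xu xv].
rewrite !par_cat !par_star // (negPf xw).
by case: (x == a); case: (x == b); case: (x == d).
Qed.

Lemma tri_sub E1 E2 a b c : {subset E1 <= E2} -> tri E1 a b c -> tri E2 a b c.
Proof. by move=> sE /and4P[uniq_abc /sE ab /sE ac /sE bc]; apply/and4P. Qed.

Lemma tri_star E a b c v : tri E a b c -> fresh E v -> tri (star v a b c ++ E) v a b.
Proof.
move=> triE fr_v; have [neq_ab _ _ _] := triP triE.
have /and3P[va vb _] := fresh_tri triE fr_v; have /and4P[_ E_ab _ _] := triE.
by rewrite /tri /= !inE E_ab !eqxx !orbT negb_or va vb neq_ab.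
Qed.

Lemma tri_fresh E a b c x : tri E a b c -> x \in [:: a; b; c] -> ~~ fresh E x.
Proof.
move=> triE; apply: contraL => /(fresh_tri triE)/and3P[xa xb xc].
by rewrite !inE !negb_or xa xb.
Qed.

(** The vertices and edges of a clip in any order: subtrees list them in an order
    of their own. *)
Definition clip a b d X S := exists w u v,
  perm_eq X [:: w; u; v] /\ perm_eq S (clip_edges a b d w u v).

(** Of a clip only the vertex [z] that it hangs on matters for the price and for
    the parities; the other two corners of its triangle are forgotten. *)
Definition attach E z X S := exists a b, tri E z a b /\ clip z a b X S.

Lemma clipC a b d X S : clip a b d X S -> clip a d b X S.
Proof.
case=> w [u [v [eqX eqS]]]; exists w, v, u; rewrite (permPl eqX) (permPl eqS).
split; first by apply/permP=> A /=; count_lia.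
by apply/permP=> A; rewrite /clip_edges /star /=; count_lia.
Qed.

Lemma attach_sub E1 E2 z X S : {subset E1 <= E2} -> attach E1 z X S -> attach E2 z X S.
Proof. by move=> sE [a [b [/(tri_sub sE) triE clipX]]]; exists a, b. Qed.

(** A point in a sequence of insertions: the graph [E] has path number at most
    [k], the vertices [X] are still to be inserted, and [f] records the parities
    at the vertices of [C], all of which belong to the graph. *)
Definition stage (C : seq T) E X k (f : T -> bool) :=
  [/\ pn E k, uniq X, all (fresh E) X & forall x, x \in C -> ~~ fresh E x /\ par E x = f x].

Lemma stage_perm C E X Y k f : perm_eq X Y -> stage C E X k f -> stage C E Y k f.
Proof. by move=> eqXY [? ? ? ?]; split; rewrite -?(perm_uniq eqXY) -?(perm_all _ eqXY). Qed.

Lemma notin_fresh E X x : all (fresh E) X -> ~~ fresh E x -> x \notin X.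
Proof. by move=> /allP fr; apply: contra => /fr. Qed.

(** The part common to all insertions: consuming [X] and updating parities. *)
Lemma stage_cat C E X Y k l f g S : stage C E (X ++ Y) k f ->
  pn (S ++ E) l ->
  (forall x, fresh E x -> x \notin X -> fresh S x) ->
  (forall x, x \notin X -> ~~ fresh E x -> par S x = g x) ->
  stage C (S ++ E) Y l (fun x => f x (+) g x).
Proof.
case=> pnE; rewrite cat_uniq all_cat => /and3P[X_uniq XY Y_uniq] /andP[X_fr Y_fr] inC.
move=> pnSE frS parS; split=> //.
  apply/allP=> x Yx; rewrite fresh_cat (allP Y_fr) // frS ?(allP Y_fr) //.
  exact: (hasPn XY).
move=> x Cx; have [old_x par_x] := inC x Cx.
rewrite fresh_cat negb_and old_x orbT par_cat par_x addbC parS //.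
exact: notin_fresh X_fr old_x.
Qed.

Lemma fresh_star v a b c x :
  fresh (star v a b c) x = [&& x != v, x != a, x != b & x != c].
Proof. by rewrite /star !fresh_cons fresh_nil !in_edge !negb_or; do 4!case: (x != _). Qed.

Lemma fresh_star_tri E a b c v x :
  tri E a b c -> fresh E x -> x != v -> fresh (star v a b c) x.
Proof. by move=> triE fr_x neq_xv; rewrite fresh_star neq_xv (fresh_tri triE). Qed.

Lemma step_leaf (C : seq T) E X k (f : T -> bool) a b c v :
  tri E a b c -> {subset [:: a; b; c] <= C} -> [|| f a, f b | f c] ->
  stage C E (v :: X) k f ->
  stage C (star v a b c ++ E) X k.+1 (fun x => f x (+) ((x == a) (+) (x == b) (+) (x == c))).
Proof.
move=> triE sC f_abc stE; have [pnE _ /andP[fr_v _] inC] := stE.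
apply: (stage_cat (X := [:: v]) stE) => [|x fr_x|x].
- apply: pn_leaf => //; rewrite -![odd _]/(par E _).
  by rewrite !(proj2 (inC _ _)) // sC // !inE eqxx ?orbT.
- by rewrite inE; apply: fresh_star_tri triE fr_x.
- by rewrite inE => neq_xv _; rewrite par_star.
Qed.

Lemma step_attach (C : seq T) E X Y S k (f : T -> bool) z :
  attach E z Y S -> z \in C -> stage C E (Y ++ X) k f ->
  stage C (S ++ E) X (k + 1 + ~~ f z) (fun x => f x (+) (x == z)).
Proof.
case=> a [b [triE [w [u [v [eqY eqS]]]]]] Cz stE.
have [pnE Y_uniq Y_fr inC] := stE.
move: Y_uniq Y_fr; rewrite cat_uniq all_cat (perm_uniq eqY) (perm_all _ eqY).
case/andP=> Y_uniq _ /andP[/and4P[fr_w fr_u fr_v _] _].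
apply: (stage_cat stE) => [|x fr_x|x].
- rewrite -(proj2 (inC z Cz)); apply: pn_perm (pn_clip triE fr_w fr_u fr_v Y_uniq pnE).
  by rewrite perm_cat2r perm_sym.
- rewrite (perm_mem eqY) !inE !negb_or (fresh_perm _ eqS) => /and3P[xw xu xv].
  have /and3P[xz xa xb] := fresh_tri triE fr_x.
  by rewrite !fresh_cat !fresh_star xw xu xv xz xa xb.
- by rewrite (perm_mem eqY) => Yx _; rewrite -(par_clip_edges z a b Yx) /par (deg_perm _ eqS).
Qed.

Lemma step_pair (C : seq T) E X k (f : T -> bool) a b c d v w :
  tri E a b c -> tri E a b d -> c != d -> c \in C -> d \in C ->
  stage C E [:: v, w & X] k f ->
  stage C (star v a b c ++ star w a b d ++ E) X (k + 1 + ~~ (f c || f d))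
     (fun x => f x (+) ((x == c) (+) (x == d))).
Proof.
move=> tri_c tri_d neq_cd Cc Cd stE; have [pnE vw_uniq /andP[fr_v /andP[fr_w _]] inC] := stE.
have neq_vw: v != w by move: vw_uniq; rewrite /= inE negb_or -!andbA => /andP[].
rewrite catA; apply: (stage_cat (X := [:: v; w]) stE) => [|x fr_x|x].
- rewrite -catA -(proj2 (inC c Cc)) -(proj2 (inC d Cd)); exact: pn_pair.
- rewrite !inE negb_or => /andP[xv xw].
  by rewrite fresh_cat (fresh_star_tri tri_c) // (fresh_star_tri tri_d).
- rewrite !inE negb_or => /andP[xv xw] _; rewrite par_cat !par_star //.
  by case: (x == a); case: (x == b); case: (x == c); case: (x == d).
Qed.

Lemma step_trio (C : seq T) E X k (f : T -> bool) a b c d u v w :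
  tri E a b c -> tri E a b d -> tri E a c d -> a \in C -> f a ->
  stage C E [:: u, v, w & X] k f ->
  stage C (star u a b c ++ star v a b d ++ star w a c d ++ E) X k.+1
     (fun x => f x (+) (x == a)).
Proof.
move=> tri_bc tri_bd tri_cd Ca fa stE.
have [pnE + /andP[fr_u /andP[fr_v /andP[fr_w _]]] inC] := stE.
rewrite -[[:: u, v, w & X]]/([:: u; v; w] ++ X) cat_uniq => /andP[uvw_uniq _].
rewrite !catA; apply: (stage_cat (X := [:: u; v; w]) stE) => [|x fr_x|x].
- rewrite -!catA; apply: pn_trio => //.
  by rewrite -[odd _]/(par E a) (proj2 (inC a Ca)).
- rewrite !inE !negb_or => /and3P[xu xv xw].
  rewrite !fresh_cat (fresh_star_tri tri_bc) //.
  by rewrite (fresh_star_tri tri_bd) // (fresh_star_tri tri_cd).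
- rewrite !inE !negb_or => /and3P[xu xv xw] _; rewrite !par_cat !par_star //.
  by case: (x == a); case: (x == b); case: (x == c); case: (x == d).
Qed.

Lemma step_chain (C : seq T) E X k (f : T -> bool) a b c v w :
  tri E a b c -> stage C E [:: v, w & X] k f ->
  stage C (star w v a b ++ star v a b c ++ E) X k.+1 (fun x => f x (+) (x == c)).
Proof.
move=> triE stE; have [pnE vw_uniq /andP[fr_v /andP[fr_w _]] inC] := stE.
have neq_vw: v != w by move: vw_uniq; rewrite /= inE negb_or -!andbA => /andP[].
rewrite catA; apply: (stage_cat (X := [:: v; w]) stE) => [|x fr_x|x].
- by rewrite -catA; apply: pn_chain.
- rewrite !inE negb_or => /andP[xv xw]; have /and3P[xa xb xc] := fresh_tri triE fr_x.
  by rewrite fresh_cat !fresh_star xv xw xa xb xc.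
- rewrite !inE negb_or => /andP[xv xw] _; rewrite par_cat !par_star // (negPf xv).
  by case: (x == a); case: (x == b); case: (x == c).
Qed.

Lemma step_clipped (C : seq T) E X Y S k (f : T -> bool) a b d y :
  tri E a b d -> d \in C -> f d -> clip a b y Y S -> stage C E (y :: Y ++ X) k f ->
  stage C (S ++ star y a b d ++ E) X k.+2 (fun x => f x (+) ((x == b) (+) (x == d))).
Proof.
move=> triE Cd fd [w [u [v [eqY eqS]]]] stE.
have [pnE yY_uniq yY_fr inC] := stE.
have eq_yY : perm_eq (y :: Y) [:: y; w; u; v] by rewrite perm_cons.
move: yY_uniq yY_fr; rewrite -cat_cons cat_uniq all_cat.
rewrite (perm_uniq eq_yY) (perm_all _ eq_yY).
case/andP=> Y_uniq _ /andP[/and5P[fr_y fr_w fr_u fr_v _] _].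
rewrite catA; apply: (stage_cat (X := y :: Y) stE) => [|x fr_x|x].
- have odd_d : odd (deg E d) by rewrite -[odd _]/(par E d) (proj2 (inC d Cd)).
  apply: pn_perm (pn_clipped triE fr_y fr_w fr_u fr_v Y_uniq odd_d pnE).
  by rewrite catA perm_cat2r perm_catC perm_cat2r perm_sym.
- rewrite (perm_mem eq_yY) !inE !negb_or fresh_cat (fresh_perm _ eqS).
  case/and4P=> xy xw xu xv; have /and3P[xa xb xd] := fresh_tri triE fr_x.
  by rewrite !fresh_cat !fresh_star xw xu xv xy xa xb xd.
- rewrite inE negb_or => /andP[xy]; rewrite (perm_mem eqY) => Yx _.
  rewrite par_cat par_star // /par (deg_perm _ eqS) -/(par _ _) par_clip_edges //.
  by case: (x == a); case: (x == b); case: (x == d).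
Qed.

Lemma pn_stage (C : seq T) E F X k l (f : T -> bool) :
  stage C E X k f -> perm_eq E F -> k <= l -> pn F l.
Proof. by case=> pnE _ _ _ eqEF le_kl; apply: pn_leq le_kl (pn_perm eqEF pnE). Qed.

Lemma stage_core (C D : seq T) E X k (f g : T -> bool) :
  stage C E X k f -> (forall x, x \in D -> ~~ fresh E x /\ par E x = g x) -> stage D E X k g.
Proof. by case=> ? ? ? _ inD; split. Qed.

(** A clip costs at most two paths; the parities are given up. *)
Lemma step_any (C : seq T) E X Y S k (f : T -> bool) z :
  attach E z Y S -> stage C E (Y ++ X) k f -> stage [::] (S ++ E) X k.+2 f.
Proof.
move=> att stE; have stz: stage [:: z] E (Y ++ X) k (par E).
  apply: stage_core stE _ => x; rewrite inE => /eqP->; split=> //.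
  have [a [b [triE _]]] := att.
  by apply: tri_fresh triE _; rewrite mem_head.
have := step_attach att (mem_head _ _) stz.
case=> pnE X_uniq X_fr _; split=> //; apply: pn_leq pnE.
by case: (par E z); lia.
Qed.

Lemma tri_rot E (a b c : T) : tri E a b c = tri E b c a.
Proof. by rewrite tri_swap12 tri_swap23. Qed.

Lemma tri_star3 E (a b c v : T) : tri E a b c -> fresh E v ->
  let F := star v a b c ++ E in [/\ tri F v a b, tri F v a c & tri F v b c].
Proof.
move=> triE fr_v; split; first exact: tri_star.
- rewrite tri_swap23 in triE; apply: tri_sub (tri_star triE fr_v); by sub_tac.
- rewrite tri_rot in triE; apply: tri_sub (tri_star triE fr_v); by sub_tac.
Qed.

(** What is left of a clip once its first vertex [w] has been inserted: a pair of
    vertices in two faces at [w], with [o1] and [o2] opposite to their common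
    edge.  It allows [w] to take part in a cheaper insertion. *)
Definition wing E w o1 o2 X S := exists z u1 u2,
  [/\ tri E w z o1, tri E w z o2, o1 != o2, perm_eq X [:: u1; u2] &
      perm_eq S (star u1 w z o1 ++ star u2 w z o2)].

Lemma wing_sub E1 E2 w o1 o2 X S :
  {subset E1 <= E2} -> wing E1 w o1 o2 X S -> wing E2 w o1 o2 X S.
Proof.
by move=> sE [z [u1 [u2 [t1 t2 ? ? ?]]]]; exists z, u1, u2; split; try exact: tri_sub sE _.
Qed.

Lemma stage_permE (C : seq T) E F X k (f : T -> bool) :
  perm_eq E F -> stage C E X k f -> stage C F X k f.
Proof.
move=> eqEF [pnE X_uniq X_fr inC]; split=> //; first exact: pn_perm pnE.
  by rewrite -(eq_all (fun x => fresh_perm x eqEF)).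
by move=> x /inC; rewrite (fresh_perm x eqEF) /par (deg_perm x eqEF).
Qed.

Lemma step_wing (C : seq T) E X Y S k (f : T -> bool) w o1 o2 :
  wing E w o1 o2 Y S -> o1 \in C -> o2 \in C -> stage C E (Y ++ X) k f ->
  stage C (S ++ E) X (k + 1 + ~~ (f o1 || f o2)) (fun x => f x (+) ((x == o1) (+) (x == o2))).
Proof.
case=> z [u1 [u2 [t1 t2 neq eqY eqS]]] C1 C2 stE.
have {}stE: stage C E [:: u1, u2 & X] k f.
  by apply: stage_perm stE; rewrite -(cat1s u2) -cat1s catA perm_cat2r.
apply: (stage_permE (E := star u1 w z o1 ++ star u2 w z o2 ++ E)).
  by rewrite catA perm_cat2r perm_sym.
exact: step_pair.
Qed.

Definition is_clip (a b c : T) X S := [\/ clip a b c X S, clip b a c X S | clip c a b X S].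

(** The clip lies in one of the three faces at [y] and hangs on one of the two
    outer vertices of that face: if it hung on [y], which has degree 3 without it,
    it would cost one path only. *)
Definition is_clipped (a b c : T) X S := exists y X' S',
  [/\ perm_eq X (y :: X'), perm_eq S (star y a b c ++ S') &
   [\/ clip a b y X' S' \/ clip a c y X' S', clip b a y X' S' \/ clip b c y X' S' |
       clip c a y X' S' \/ clip c b y X' S']].

Lemma is_clip_attach a b c X S : is_clip a b c X S ->
  exists2 z, z \in [:: a; b; c] & forall E, tri E a b c -> attach E z X S.
Proof.
case=> cl; [exists a | exists b | exists c]; rewrite ?inE ?eqxx ?orbT // => E triE.
- by exists b, c.
- by exists a, c; rewrite tri_swap12.
- by exists a, b; rewrite tri_swap12 tri_swap23.
Qed.

Lemma is_clipped_attach a b c X S : is_clipped a b c X S ->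
  exists y X' S', [/\ perm_eq X (y :: X'), perm_eq S (star y a b c ++ S') &
    exists2 z, z \in [:: a; b; c] &
      forall E, tri E a b c -> fresh E y -> attach (star y a b c ++ E) z X' S'].
Proof.
case=> y [X' [S' [eqX eqS cl]]]; exists y, X', S'; split=> //.
case: cl => [[]|[]|[]] cl; [exists a|exists a|exists b|exists b|exists c|exists c];
  rewrite ?inE ?eqxx ?orbT // => E triE fr_y; have [t1 t2 t3] := tri_star3 triE fr_y.
- by exists b, y; rewrite -tri_rot.
- by exists c, y; rewrite -tri_rot.
- by exists a, y; rewrite -tri_rot tri_swap23.
- by exists c, y; rewrite -tri_rot.
- by exists a, y; rewrite -tri_rot tri_swap23.
- by exists b, y; rewrite -tri_rot tri_swap23.
Qed.

Lemma is_clip_wing (a b c : T) X S : is_clip a b c X S ->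
  exists w Y R o1 o2, [/\ perm_eq X (w :: Y), perm_eq S (star w a b c ++ R),
    o1 \in [:: a; b; c], o2 \in [:: a; b; c] &
    forall E, tri E a b c -> fresh E w -> wing (star w a b c ++ E) w o1 o2 Y R].
Proof.
case=> -[w [u [v [eqX eqS]]]]; exists w, [:: u; v].
- exists (star u w a b ++ star v w a c), b, c.
  split; rewrite ?(permPl eqS) // ?inE ?eqxx ?orbT // => E triE fr_w.
  by have [t1 t2 t3] := tri_star3 triE fr_w; have [_ _ ? _] := triP triE; exists a, u, v.
- exists (star u w b a ++ star v w b c), a, c.
  split; rewrite ?(permPl eqS) // ?inE ?eqxx ?orbT //; first by perm_edges.
  move=> E triE fr_w; have [t1 t2 t3] := tri_star3 triE fr_w.
  by have [_ ? _ _] := triP triE; exists b, u, v; split; rewrite // tri_swap23.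
- exists (star u w c a ++ star v w c b), a, b.
  split; rewrite ?(permPl eqS) // ?inE ?eqxx ?orbT //; first by perm_edges.
  move=> E triE fr_w; have [t1 t2 t3] := tri_star3 triE fr_w.
  by have [? _ _ _] := triP triE; exists c, u, v; split; rewrite // tri_swap23.
Qed.

(** When the clip in the face [vab] hangs on [a] or [b], there is a second option:
    insert [v] and the clip together, for two paths, if [c] is odd outside. *)
Lemma is_clip_apex E0 (a b c v : T) X S :
  tri E0 a b c -> fresh E0 v -> is_clip v a b X S ->
  exists z, [/\ z \in [:: v; a; b], attach (star v a b c ++ E0) z X S &
    z != v -> par E0 c -> forall Y k, uniq (v :: X ++ Y) -> all (fresh E0) (v :: X ++ Y) ->
    pn E0 k -> stage [::] (S ++ star v a b c ++ E0) Y k.+2 (fun=> false)].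
Proof.
move=> tri0 fr_v clipX; have [t1 _ _] := tri_star3 tri0 fr_v.
have left x y : tri E0 x y c -> par E0 c -> clip x y v X S -> forall Y k,
    uniq (v :: X ++ Y) -> all (fresh E0) (v :: X ++ Y) ->
    pn E0 k -> stage [::] (S ++ star v x y c ++ E0) Y k.+2 (fun=> false).
  move=> tri_xy odd_c cl Y k Y_uniq Y_fr pn0.
  have stE: stage [:: c] E0 (v :: X ++ Y) k (par E0).
    split=> // z; rewrite inE => /eqP->; split=> //.
    by apply: tri_fresh tri0 _; rewrite !inE eqxx !orbT.
  by apply: stage_core (step_clipped tri_xy (mem_head _ _) odd_c cl stE) _.
case: clipX => cl.
- by exists v; rewrite mem_head eqxx; split=> //; exists a, b.
- exists a; rewrite !inE eqxx orbT; split=> //.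
    by exists v, b; rewrite tri_swap12.
  move=> _ odd_c; apply: left => //; exact: clipC.
- exists b; rewrite !inE eqxx !orbT; split=> //.
    by exists v, a; rewrite tri_rot.
  move=> _ odd_c Y k Y_uniq Y_fr pn0.
  have t0 : tri E0 b a c by rewrite tri_swap12.
  apply: stage_permE (left b a t0 odd_c (clipC cl) Y k Y_uniq Y_fr pn0).
  by perm_edges.
Qed.

End Gadgets.

(** * Reductions at a stacked vertex *)

(** Throughout, [v] is stacked in the triangle [abc] of [E0]. *)
Section Reductions.
Variables (T : finType) (E0 : seq {set T}) (a b c v : T).
Hypotheses (tri0 : tri E0 a b c) (fr_v : fresh E0 v).
Implicit Types (X : seq T) (E S : seq {set T}).

Local Notation E1 := (star v a b c ++ E0).

Definition all_even := ~~ [|| par E0 a, par E0 b | par E0 c].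

(** Everything inside [abc] is removed, [m] vertices in all, or [v] is retained
    and the other [m - 1] vertices are removed.  In the first case [E0] may be a
    bare triangle, whose two paths exceed the bound by one eighth; then all its
    degrees are even, and one eighth has to be left over.  In the second case
    [0 < r] ensures that something is removed. *)
Definition reducible m S :=
  (exists2 r, 8 * r + all_even <= 5 * m & forall k, pn E0 k -> pn (S ++ E0) (k + r)) \/
  (exists2 r, (0 < r) && (8 * r + 5 <= 5 * m) & forall k, pn E1 k -> pn (S ++ E0) (k + r)).

Definition fresh_verts X := uniq (v :: X) && all (fresh E0) (v :: X).

Lemma fresh_verts_perm X Y : perm_eq X Y -> fresh_verts X = fresh_verts Y.
Proof.
move=> eqXY; rewrite /fresh_verts !cons_uniq (perm_mem eqXY) (perm_uniq eqXY).
by rewrite /= (perm_all _ eqXY).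
Qed.

Lemma neqs : [/\ v != a, v != b, v != c & uniq [:: a; b; c]].
Proof.
have /and3P[-> -> ->] := fresh_tri tri0 fr_v.
by split=> //; case/and4P: tri0.
Qed.

Lemma stage_outside X k : fresh_verts X -> pn E0 k -> stage [:: a; b; c] E0 (v :: X) k (par E0).
Proof.
case/andP=> ? ? ?; split=> // x abc_x; split=> //.
exact: tri_fresh tri0 abc_x.
Qed.

(** With [v] inserted, [v] is odd and the three outer parities are flipped. *)
Lemma stage_inside X k : fresh_verts X -> pn E1 k ->
  stage [:: v; a; b; c] E1 X k (fun x => (x == v) || ~~ par E0 x).
Proof.
case/andP=> /andP[Xv X_uniq] /andP[_ X_fr] pn1; split=> //.
  apply/allP=> x Xx; rewrite fresh_cat (allP X_fr x Xx) andbT.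
  apply: fresh_star_tri tri0 (allP X_fr x Xx) _.
  by apply: contraNneq Xv => <-.
move=> x; rewrite inE; case: eqP => [-> _|/eqP neq_xv abc_x].
  split; first by rewrite fresh_cat fresh_star eqxx.
  have [va vb vc _] := neqs.
  rewrite par_cat {2}/par (deg_fresh fr_v) addbF /par /deg /= !in_edge eqxx.
  by rewrite (negPf va) (negPf vb) (negPf vc).
rewrite fresh_cat negb_and (tri_fresh tri0 abc_x) orbT; split=> //.
rewrite par_cat par_star //; case/and4P: tri0; rewrite /= !inE !negb_or andbT.
move=> /andP[/andP[ab ac] bc] _ _ _; move: abc_x; rewrite !inE /=.
by case/or3P=> /eqP->; rewrite ?eqxx ?(eq_sym b a) ?(eq_sym c)
  ?(negPf ab) ?(negPf ac) ?(negPf bc) ?addbF ?addFb ?addTb.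
Qed.

Lemma tri1 : [/\ tri E1 v a b, tri E1 v a c & tri E1 v b c].
Proof. exact: tri_star3. Qed.

Lemma fresh_verts_inside X x : fresh_verts X -> x \in X -> fresh E1 x.
Proof.
case/andP=> /andP[Xv _] /andP[_ X_fr] Xx; rewrite fresh_cat (allP X_fr x Xx) andbT.
apply: fresh_star_tri tri0 (allP X_fr x Xx) _.
by apply: contraNneq Xv => <-.
Qed.

Lemma neq_rw :
  ((v == a) = false) * ((v == b) = false) * ((v == c) = false) *
  ((a == v) = false) * ((b == v) = false) * ((c == v) = false) *
  ((a == b) = false) * ((a == c) = false) * ((b == c) = false) *
  ((b == a) = false) * ((c == a) = false) * ((c == b) = false).
Proof.
have [va vb vc] := neqs; rewrite /= !inE negb_or andbT => /andP[/andP[ab ac] bc].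
by do !split; apply: negPf; rewrite // eq_sym.
Qed.

Ltac perm_cats := apply/permP => ?; rewrite ?count_cat; count_lia.
Ltac perm_verts := apply/permP => ?; rewrite /= ?count_cat /= ?count_cat /=; count_lia.
Ltac by_parity := rewrite /= ?eqxx ?neq_rw;
  case: (par E0 a); case: (par E0 b); case: (par E0 c); rewrite //=; clear; lia.

(** The three letters tell what is stacked in the faces [vab], [vac], [vbc]: E for
    nothing, L for a single vertex, B for a clip, C for a clipped vertex. *)
Lemma red_LEE y : fresh_verts [:: y] -> reducible 2 (star y v a b ++ star v a b c).
Proof.
move=> nw; left; exists 1 => [|k pn0]; first by case: all_even.
apply: pn_stage (step_chain tri0 (stage_outside nw pn0)) _ _; last by rewrite addn1.
by perm_cats.
Qed.

Lemma red_LLL x y z : fresh_verts [:: x; y; z] ->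
  reducible 4 (star x v a b ++ star y v a c ++ star z v b c ++ star v a b c).
Proof.
move=> nw; right; exists 1 => // k pn1; have [t1 t2 t3] := tri1.
apply: pn_stage (step_trio t1 t2 t3 (mem_head _ _) _ (stage_inside nw pn1)) _ _.
- by rewrite eqxx.
- by perm_cats.
- by rewrite addn1.
Qed.

Lemma red_BEE X S : fresh_verts (X ++ [::]) -> attach E1 v X S -> reducible 4 (S ++ star v a b c).
Proof.
move=> nw att; right; exists 1 => // k pn1.
apply: pn_stage (step_attach att (mem_head _ _) (stage_inside nw pn1)) _ _; first by perm_cats.
by rewrite eqxx /= addn0.
Qed.

(** [v] and [y] form a chain of price one, the clip costs at most two. *)
Lemma red_BLE X S z y : fresh_verts (y :: X ++ [::]) -> attach E1 z X S ->
  reducible 5 (S ++ star y v a c ++ star v a b c).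
Proof.
move=> nw att; left; exists 3 => [|k pn0]; first by case: all_even.
have t0 : tri E0 a c b by rewrite tri_swap23.
have s1 := step_chain t0 (stage_outside nw pn0).
have s2 := step_any (attach_sub _ att) s1.
apply: pn_stage (s2 _) _ _; first by sub_tac.
  by rewrite /star; perm_edges.
by clear; lia.
Qed.

Lemma red_CEE X S z y : fresh_verts (y :: X ++ [::]) -> attach (star y v a b ++ E1) z X S ->
  reducible 5 (S ++ star y v a b ++ star v a b c).
Proof.
move=> nw att; left; exists 3 => [|k pn0]; first by case: all_even.
have s1 := step_chain tri0 (stage_outside nw pn0).
have s2 := step_any att s1.
apply: pn_stage s2 _ _; first by perm_cats.
by clear; lia.
Qed.

(** The first vertex [w] of the clip joins [x] and [y] in a trio at [v]. *)
Lemma red_BLL w Y R o1 o2 x y : fresh_verts [:: w, x, y & Y ++ [::]] ->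
  wing (star w v a b ++ E1) w o1 o2 Y R -> o1 \in [:: v; a; b] -> o2 \in [:: v; a; b] ->
  reducible 6 (R ++ star w v a b ++ star x v a c ++ star y v b c ++ star v a b c).
Proof.
move=> nw wg o1in o2in; right; exists 3 => // k pn1; have [t1 t2 t3] := tri1.
have core o : o \in [:: v; a; b] -> o \in [:: v; a; b; c].
  by rewrite !inE => /or3P[]->; rewrite ?orbT.
have s1 := step_trio t1 t2 t3 (mem_head _ _) _ (stage_inside nw pn1).
have s2 := step_wing (wing_sub _ wg) (core _ o1in) (core _ o2in) (s1 _).
apply: pn_stage (s2 _ _) _ _.
- by sub_tac.
- by rewrite eqxx.
- by perm_cats.
- by case: (~~ _); clear; lia.
Qed.

Lemma core_vab z : z \in [:: v; a; b] -> z \in [:: v; a; b; c].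
Proof. by rewrite !inE => /or3P[]->; rewrite ?orbT. Qed.

Lemma core_vac z : z \in [:: v; a; c] -> z \in [:: v; a; b; c].
Proof. by rewrite !inE => /or3P[]->; rewrite ?orbT. Qed.

Lemma core_vbc z : z \in [:: v; b; c] -> z \in [:: v; a; b; c].
Proof. by rewrite !inE => /or3P[]->; rewrite ?orbT. Qed.

Lemma neq_bc : b != c. Proof. by rewrite neq_rw. Qed.

(** Keeping [v], insert the pair [y], [l] with opposite vertices [b] and [c], then
    the clip: one of the two is cheap unless the clip hangs on [a] and [a] is odd
    in [E0].  In that case [v], [y], [l] form themselves a clip on [a], which is
    cheap. *)
Lemma red_CLE y X S z l : fresh_verts [:: y, l & X ++ [::]] ->
  z \in [:: v; a; b] -> attach (star y v a b ++ E1) z X S ->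
  reducible 6 (S ++ star y v a b ++ star l v a c ++ star v a b c).
Proof.
move=> nw zin att; have [t1 t2 t3] := tri1.
case: (boolP ((z == a) && par E0 a)) => [/andP[_ odd_a]|not_a].
  left; exists 3 => [|k pn0]; first by case: all_even.
  have att0: attach E0 a [:: v; y; l] (star v a b c ++ star y v a b ++ star l v a c).
    by exists b, c; split=> //; exists v, y, l.
  have s1 := step_attach att0 (mem_head _ _) (stage_outside nw pn0).
  have s2 := step_any (attach_sub _ att) s1.
  apply: pn_stage (s2 _) _ _; first by sub_tac.
    by perm_cats.
  by rewrite odd_a /=; clear; lia.
right; exists 3 => // k pn1.
have s1 := step_pair t1 t2 neq_bc (core_vab _) (core_vac _) (stage_inside nw pn1).
have s2 := step_attach (attach_sub _ att) (core_vab zin) (s1 _ _).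
apply: pn_stage (s2 _ _ _) _ _; rewrite ?inE ?eqxx ?orbT //; first by sub_tac.
  by perm_cats.
move: zin not_a; rewrite !inE => /or3P[]/eqP->; by_parity.
Qed.

Lemma red_CLL y X S z x l : fresh_verts [:: y, x, l & X ++ [::]] ->
  z \in [:: v; a; b] -> attach (star y v a b ++ E1) z X S ->
  reducible 7 (S ++ star y v a b ++ star x v a c ++ star l v b c ++ star v a b c).
Proof.
move=> nw zin att; right; exists 3 => // k pn1; have [t1 t2 t3] := tri1.
have s1 := step_trio t1 t2 t3 (mem_head _ _) _ (stage_inside nw pn1).
have s2 := step_any (attach_sub _ att) (s1 _).
apply: pn_stage (s2 _ _) _ _; rewrite ?eqxx //; first by sub_tac.
  by perm_cats.
by clear; lia.
Qed.

(** The pair [y], [y'] and the two clips cost at most six paths, and one can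
    always be saved: [v] is odd, clips on the same vertex make each other cheap,
    and one of the pair and a clip on a vertex opposite to it is cheap. *)
Lemma red_CCE y X S z y' X' S' z' : fresh_verts [:: y, y' & X ++ X' ++ [::]] ->
  z \in [:: v; a; b] -> attach (star y v a b ++ E1) z X S ->
  z' \in [:: v; a; c] -> attach (star y' v a c ++ E1) z' X' S' ->
  reducible 9 (S' ++ S ++ star y v a b ++ star y' v a c ++ star v a b c).
Proof.
move=> nw zin att zin' att'; right; exists 5 => // k pn1; have [t1 t2 t3] := tri1.
have s1 := step_pair t1 t2 neq_bc (core_vab _) (core_vac _) (stage_inside nw pn1).
have s2 := step_attach (attach_sub _ att) (core_vab zin) (s1 _ _).
have s3 := step_attach (attach_sub _ att') (core_vac zin') (s2 _ _ _).
apply: pn_stage (s3 _ _ _ _) _ _; rewrite ?inE ?eqxx ?orbT //; try by sub_tac.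
  by perm_cats.
by move: zin zin'; rewrite !inE => /or3P[]/eqP-> /or3P[]/eqP->; by_parity.
Qed.

Lemma red_CCL y X S z y' X' S' z' l : fresh_verts [:: y, y', l & X ++ X' ++ [::]] ->
  attach (star y v a b ++ E1) z X S -> attach (star y' v a c ++ E1) z' X' S' ->
  reducible 10 (S' ++ S ++ star y v a b ++ star y' v a c ++ star l v b c ++ star v a b c).
Proof.
move=> nw att att'; right; exists 5 => // k pn1; have [t1 t2 t3] := tri1.
have s1 := step_trio t1 t2 t3 (mem_head _ _) _ (stage_inside nw pn1).
have s2 := step_any (attach_sub _ att) (s1 _).
have s3 := step_any (attach_sub _ att') (s2 _ _).
apply: pn_stage (s3 _ _ _) _ _; rewrite ?eqxx //; try by sub_tac.
  by perm_cats.
by clear; lia.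
Qed.

Lemma red_CCC y X S z y' X' S' z' y'' X'' S'' z'' :
  fresh_verts [:: y, y', y'' & X ++ X' ++ X'' ++ [::]] ->
  attach (star y v a b ++ E1) z X S -> attach (star y' v a c ++ E1) z' X' S' ->
  attach (star y'' v b c ++ E1) z'' X'' S'' ->
  reducible 13 (S'' ++ S' ++ S ++ star y v a b ++ star y' v a c ++ star y'' v b c ++ star v a b c).
Proof.
move=> nw att att' att''; right; exists 7 => // k pn1; have [t1 t2 t3] := tri1.
have s1 := step_trio t1 t2 t3 (mem_head _ _) _ (stage_inside nw pn1).
have s2 := step_any (attach_sub _ att) (s1 _).
have s3 := step_any (attach_sub _ att') (s2 _ _).
have s4 := step_any (attach_sub _ att'') (s3 _ _ _).
apply: pn_stage (s4 _ _ _ _) _ _; rewrite ?eqxx //; try by sub_tac.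
  by perm_cats.
by clear; lia.
Qed.

Lemma red_CBL y X S z w Y R o1 o2 l : fresh_verts [:: y, w, l & Y ++ X ++ [::]] ->
  attach (star y v a b ++ E1) z X S ->
  wing (star w v a c ++ E1) w o1 o2 Y R -> o1 \in [:: v; a; c] -> o2 \in [:: v; a; c] ->
  reducible 9 (S ++ R ++ star y v a b ++ star w v a c ++ star l v b c ++ star v a b c).
Proof.
move=> nw att wg o1in o2in; right; exists 5 => // k pn1; have [t1 t2 t3] := tri1.
have s1 := step_trio t1 t2 t3 (mem_head _ _) _ (stage_inside nw pn1).
have s2 := step_wing (wing_sub _ wg) (core_vac o1in) (core_vac o2in) (s1 _).
have s3 := step_any (attach_sub _ att) (s2 _ _).
apply: pn_stage (s3 _ _ _) _ _; rewrite ?eqxx //; try by sub_tac.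
  by perm_cats.
by case: (~~ _); clear; lia.
Qed.

(** [v], [y], [y'] are inserted as a clip on [a].  Then [v] has the odd degree 5, so
    a clip on [v] is cheap; so is a second clip on the same vertex, and a clip on
    [a] unless the first one was cheap.  No choice of the three vertices escapes. *)
Lemma red_CCB y X S z y' X' S' z' X'' S'' z'' :
  fresh_verts [:: y, y' & X ++ X' ++ X'' ++ [::]] ->
  z \in [:: v; a; b] -> attach (star y v a b ++ E1) z X S ->
  z' \in [:: v; a; c] -> attach (star y' v a c ++ E1) z' X' S' ->
  z'' \in [:: v; b; c] -> attach E1 z'' X'' S'' ->
  reducible 12 (S'' ++ S' ++ S ++ star y v a b ++ star y' v a c ++ star v a b c).
Proof.
move=> nw zin att zin' att' zin'' att''; left; exists 7 => [|k pn0]; first by case: all_even.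
have att0: attach E0 a [:: v; y; y'] (star v a b c ++ star y v a b ++ star y' v a c).
  by exists b, c; split=> //; exists v, y, y'.
have s1 := step_attach att0 (mem_head _ _) (stage_outside nw pn0).
set f := (fun x => (x == v) || (par E0 x (+) (x == a))).
have s1': stage [:: v; a; b; c] ((star v a b c ++ star y v a b ++ star y' v a c) ++ E0)
    (X ++ X' ++ X'' ++ [::]) (k + 1 + ~~ par E0 a) f.
  apply: (stage_core s1) => x; rewrite inE => /orP[/eqP->|abc_x].
    rewrite /f eqxx; split; first by rewrite !fresh_cat !fresh_star eqxx.
    have [vy vy']: v != y /\ v != y'.
      by case/andP: nw; rewrite /= !inE !negb_or -!andbA => /and3P[].
    rewrite !par_cat !(par_star _ _ _ vy) !(par_star _ _ _ vy').
    by rewrite {2}/par (deg_fresh fr_v) /par /deg /= !in_edge eqxx ?neq_rw.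
  have [_ _ _ inC] := s1; have [old_x ->] := inC x abc_x; split=> //.
  have neq_xv: (x == v) = false.
    by apply: contraTF abc_x => /eqP->; rewrite !inE !neq_rw.
  by rewrite /f neq_xv.
have s2 := step_attach (attach_sub _ att) (core_vab zin) s1'.
have s3 := step_attach (attach_sub _ att') (core_vac zin') (s2 _).
have s4 := step_attach (attach_sub _ att'') (core_vbc zin'') (s3 _ _).
apply: pn_stage (s4 _ _ _) _ _; rewrite ?eqxx //; try by sub_tac.
  by perm_cats.
rewrite /f; move: zin zin' zin''; rewrite !inE.
by move=> /or3P[]/eqP-> /or3P[]/eqP-> /or3P[]/eqP->; by_parity.
Qed.

(** Two clips cost three paths unless they hang on distinct outer vertices that are
    even once [v] is inserted.  These are then odd in [E0], and one of the clips can be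
    inserted together with [v] by [is_clip_apex]. *)
Lemma red_BBE X S X' S' : fresh_verts (X ++ X' ++ [::]) ->
  is_clip v a b X S -> is_clip v a c X' S' ->
  reducible 7 (S' ++ S ++ star v a b c).
Proof.
move=> nw clipX clipX'; have tri0' : tri E0 a c b by rewrite tri_swap23.
have [z [zin att alt]] := is_clip_apex tri0 fr_v clipX.
have [z' [zin' att' alt']] := is_clip_apex tri0' fr_v clipX'.
have {}att' : attach E1 z' X' S' by apply: attach_sub att'; sub_tac.
case: (boolP ((z != v) && par E0 c)) => [/andP[zv odd_c]|c_even].
  left; exists 4 => [|k pn0]; first by case: all_even.
  have /andP[nw1 nw2] := nw.
  have s1 := step_any (attach_sub _ att') (alt zv odd_c _ _ nw1 nw2 pn0).
  apply: pn_stage (s1 _) _ _; first by sub_tac.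
    by perm_cats.
  by clear; lia.
case: (boolP ((z' != v) && par E0 b)) => [/andP[zv' odd_b]|b_even].
  left; exists 4 => [|k pn0]; first by case: all_even.
  have : fresh_verts (X' ++ X ++ [::]).
    by rewrite -(fresh_verts_perm (_ : perm_eq (X ++ X' ++ [::]) _)) //; perm_verts.
  case/andP=> nw1 nw2.
  have s1 := step_any (attach_sub _ att) (alt' zv' odd_b _ _ nw1 nw2 pn0).
  apply: pn_stage (s1 _) _ _; first by sub_tac.
    by rewrite /star; perm_edges.
  by clear; lia.
right; exists 3 => // k pn1.
have s1 := step_attach att (core_vab zin) (stage_inside nw pn1).
have s2 := step_attach (attach_sub _ att') (core_vac zin') (s1).
apply: pn_stage (s2 _) _ _; first by sub_tac.
  by perm_cats.
move: zin zin' c_even b_even; rewrite !inE.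
by move=> /or3P[]/eqP-> /or3P[]/eqP->; by_parity.
Qed.

Lemma red_BBB X S X' S' z' X'' S'' z'' : fresh_verts (X ++ X' ++ X'' ++ [::]) ->
  is_clip v a b X S -> z' \in [:: v; a; c] -> attach E1 z' X' S' ->
  z'' \in [:: v; b; c] -> attach E1 z'' X'' S'' ->
  reducible 10 (S'' ++ S' ++ S ++ star v a b c).
Proof.
move=> nw clipX zin' att' zin'' att''.
have [z [zin att alt]] := is_clip_apex tri0 fr_v clipX.
case: (boolP ((z != v) && par E0 c)) => [/andP[zv odd_c]|c_even].
  left; exists 6 => [|k pn0]; first by case: all_even.
  have /andP[nw1 nw2] := nw.
  have s1 := step_any (attach_sub _ att') (alt zv odd_c _ _ nw1 nw2 pn0).
  have s2 := step_any (attach_sub _ att'') (s1 _).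
  apply: pn_stage (s2 _ _) _ _; try by sub_tac.
    by perm_cats.
  by clear; lia.
right; exists 5 => // k pn1.
have s1 := step_attach att (core_vab zin) (stage_inside nw pn1).
have s2 := step_attach (attach_sub _ att') (core_vac zin') s1.
have s3 := step_attach (attach_sub _ att'') (core_vbc zin'') (s2 _).
apply: pn_stage (s3 _ _) _ _; try by sub_tac.
  by perm_cats.
move: zin zin' zin'' c_even; rewrite !inE.
by move=> /or3P[]/eqP-> /or3P[]/eqP-> /or3P[]/eqP->; by_parity.
Qed.

(** Removing everything leaves no slack for a bare triangle, so this is done only
    if some outer degree is odd.  If all are even they become odd with [v], which
    makes one wing cheap after a trio at [v]. *)
Lemma red_BBL X S X' S' l : fresh_verts (l :: X ++ X' ++ [::]) ->
  is_clip v a b X S -> is_clip v a c X' S' ->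
  reducible 8 (S' ++ S ++ star l v b c ++ star v a b c).
Proof.
move=> nw clipX clipX'; have [t1 t2 t3] := tri1.
case: (boolP all_even) => [ev|/negPf not_ev]; last first.
  have [z _ att] := is_clip_attach clipX; have [z' _ att'] := is_clip_attach clipX'.
  left; exists 5 => [|k pn0]; first by rewrite not_ev.
  have tri0' : tri E0 b c a by rewrite -tri_rot.
  have s1 := step_chain tri0' (stage_outside nw pn0).
  have s2 := step_any (attach_sub _ (att _ t1)) s1.
  have s3 := step_any (attach_sub _ (att' _ t2)) (s2 _).
  apply: pn_stage (s3 _ _) _ _; try by sub_tac.
    by rewrite /star; perm_edges.
  by clear; lia.
have [w [Y [R [o1 [o2 [eqX eqS o1in o2in wg]]]]]] := is_clip_wing clipX.
have [w' [Y' [R' [o1' [o2' [eqX' eqS' o1in' o2in' wg']]]]]] := is_clip_wing clipX'.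
right; exists 4 => // k pn1.
have nw1 : fresh_verts [:: w, w', l & Y ++ Y' ++ [::]].
  rewrite -(fresh_verts_perm (_ : perm_eq (l :: X ++ X' ++ [::]) _)) //.
  by apply/permP=> A; move: (permP eqX A) (permP eqX' A); rewrite /= !count_cat /=; count_lia.
have {}wg := wg _ t1 (fresh_verts_inside nw1 (mem_head _ _)).
have {}wg' := wg' _ t2 (fresh_verts_inside nw1 _).
have s1 := step_trio t1 t2 t3 (mem_head _ _) _ (stage_inside nw1 pn1).
have neq_o : o1 != o2 by case: wg => ? [? [? []]].
have s2 := step_wing (wing_sub _ wg) (core_vab o1in) (core_vab o2in) (s1 _).
have s3 := step_wing (wing_sub _ (wg' _)) (core_vac o1in') (core_vac o2in') (s2 _ _).
apply: pn_stage (s3 _ _ _ _) _ _; rewrite ?inE ?eqxx ?orbT //; try by sub_tac.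
  apply/permP=> A; move: (permP eqS A) (permP eqS' A); rewrite !count_cat; count_lia.
(* The first wing costs one path, as one of [o1] and [o2] is [a] or [b] and both
   are odd by now; the second costs at most two. *)
apply: leq_trans (leq_add (leq_add (leq_add (leqnn _) (_ : _ <= 0)) (leqnn 1))
                          (leq_b1 _)) _; last by clear; lia.
move: o1in o2in neq_o ev; rewrite /all_even !inE.
by move=> /or3P[]/eqP-> /or3P[]/eqP->; rewrite ?eqxx //= ?neq_rw => _;
  case: (par E0 a); case: (par E0 b); case: (par E0 c).
Qed.

(** The same dichotomy as in [red_BBL].  With odd [a], [b], [c] and [v] the clip in
    [vac] and then [y] are cheap. *)
Lemma red_CBE y X S z X' S' z' : fresh_verts (y :: X ++ X' ++ [::]) ->
  z \in [:: v; a; b] -> attach (star y v a b ++ E1) z X S ->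
  z' \in [:: v; a; c] -> attach E1 z' X' S' ->
  reducible 8 (S ++ S' ++ star y v a b ++ star v a b c).
Proof.
move=> nw zin att zin' att'; have [t1 t2 t3] := tri1.
case: (boolP all_even) => [ev|/negPf not_ev]; last first.
  left; exists 5 => [|k pn0]; first by rewrite not_ev.
  have s1 := step_chain tri0 (stage_outside nw pn0).
  have s2 := step_any att s1.
  have s3 := step_any (attach_sub _ att') (s2).
  apply: pn_stage (s3 _) _ _; try by sub_tac.
    by perm_cats.
  by clear; lia.
right; exists 4 => // k pn1.
have s0 := stage_perm (Y := X' ++ y :: X ++ [::]) _ (stage_inside nw pn1).
have s1 := step_attach att' (core_vac zin') (s0 _).
have s2 := step_leaf (tri_sub _ t1) core_vab _ (s1 _).
have s3 := step_attach (attach_sub _ att) (core_vab zin) (s2 _ _ _).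
apply: pn_stage (s3 _ _ _ _) _ _; try by sub_tac.
- move: zin' ev; rewrite /all_even !inE.
  by move=> /or3P[]/eqP->; rewrite ?eqxx ?neq_rw;
    case: (par E0 a); case: (par E0 b); case: (par E0 c).
- by perm_verts.
- by perm_cats.
move: zin zin' ev; rewrite /all_even !inE.
by move=> /or3P[]/eqP-> /or3P[]/eqP->; by_parity.
Qed.

(** [y] costs one path if it comes first, as [v] is then odd, and it remains cheap
    after a clip if that leaves one of [v], [a], [b] odd.  With it and three clips
    of price two, one path has to be saved out of seven.  One of the three orders
    below does so, for all positions of the clips and all parities. *)
Lemma red_CBB y X S z X' S' z' X'' S'' z'' : fresh_verts (y :: X ++ X' ++ X'' ++ [::]) ->
  z \in [:: v; a; b] -> attach (star y v a b ++ E1) z X S ->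
  z' \in [:: v; a; c] -> attach E1 z' X' S' ->
  z'' \in [:: v; b; c] -> attach E1 z'' X'' S'' ->
  reducible 11 (S ++ S' ++ S'' ++ star y v a b ++ star v a b c).
Proof.
move=> nw zin att zin' att' zin'' att''; have [t1 t2 t3] := tri1.
right; exists 6 => // k pn1; rewrite -!catA.
set F := S ++ _; pose f x := (x == v) || ~~ par E0 x.
pose leaf x := (x == v) (+) (x == a) (+) (x == b).
have pA : pn F (k.+1 + 1 + ~~ (f z (+) leaf z) + 1 + ~~ (f z' (+) leaf z' (+) (z' == z))
    + 1 + ~~ (f z'' (+) leaf z'' (+) (z'' == z) (+) (z'' == z'))).
  have s1 := step_leaf t1 core_vab _ (stage_inside nw pn1).
  have s2 := step_attach att (core_vab zin) (s1 _).
  have s3 := step_attach (attach_sub _ att') (core_vac zin') (s2 _).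
  have s4 := step_attach (attach_sub _ att'') (core_vbc zin'') (s3 _ _).
  apply: pn_stage (s4 _ _ _) _ (leqnn _); rewrite ?eqxx //; try by sub_tac.
  by perm_cats.
have pB : [|| f v (+) (v == z'), f a (+) (a == z') | f b (+) (b == z')] ->
    pn F ((k + 1 + ~~ f z').+1 + 1 + ~~ (f z (+) (z == z') (+) leaf z) + 1 +
          ~~ (f z'' (+) (z'' == z') (+) leaf z'' (+) (z'' == z))).
  move=> odd_face.
  have s0 := stage_perm (Y := X' ++ y :: X ++ X'' ++ [::]) _ (stage_inside nw pn1).
  have s1 := step_attach att' (core_vac zin') (s0 _).
  have s2 := step_leaf (tri_sub _ t1) core_vab odd_face (s1 _).
  have s3 := step_attach (attach_sub _ att) (core_vab zin) (s2 _ _).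
  have s4 := step_attach (attach_sub _ att'') (core_vbc zin'') (s3 _ _ _).
  apply: pn_stage (s4 _ _ _ _) _ (leqnn _); try by sub_tac.
    by perm_verts.
  by perm_cats.
have pC : [|| f v (+) (v == z''), f a (+) (a == z'') | f b (+) (b == z'')] ->
    pn F ((k + 1 + ~~ f z'').+1 + 1 + ~~ (f z (+) (z == z'') (+) leaf z) + 1 +
          ~~ (f z' (+) (z' == z'') (+) leaf z' (+) (z' == z))).
  move=> odd_face.
  have s0 := stage_perm (Y := X'' ++ y :: X ++ X' ++ [::]) _ (stage_inside nw pn1).
  have s1 := step_attach att'' (core_vbc zin'') (s0 _).
  have s2 := step_leaf (tri_sub _ t1) core_vab odd_face (s1 _).
  have s3 := step_attach (attach_sub _ att) (core_vab zin) (s2 _ _).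
  have s4 := step_attach (attach_sub _ att') (core_vac zin') (s3 _ _ _).
  apply: pn_stage (s4 _ _ _ _) _ (leqnn _); try by sub_tac.
    by perm_verts.
  by perm_cats.
move: pA pB pC; rewrite /f /leaf; move: F => F.
have le6 n : n <= k + 6 -> pn F n -> pn F (k + 6) by exact: pn_leq.
move: zin zin' zin''; rewrite !inE.
move=> /or3P[]/eqP-> /or3P[]/eqP-> /or3P[]/eqP->; rewrite ?eqxx ?neq_rw;
  case: (par E0 a); case: (par E0 b); case: (par E0 c) => /= pA pB pC;
  first [apply: le6 pA; clear; lia | apply: le6 (pB isT); clear; lia
        | apply: le6 (pC isT); clear; lia].
Qed.

End Reductions.

Section Dispatch.
Variable T : finType.
Implicit Types (a b c v : T) (X Y : seq T) (E S R : seq {set T}).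

(** * Every tree of stackings is a stub or shrinks *)

(** Numbering the stubs lets the symmetries of a triangle sort three subtrees. *)
Definition stub n a b c X S :=
  match n with
  | 0 => X = [::] /\ S = [::]
  | 1 => exists v, X = [:: v] /\ perm_eq S (star v a b c)
  | 2 => is_clip a b c X S
  | 3 => is_clipped a b c X S
  | _ => False
  end.

Lemma reducible_perm E0 a b c v m S R :
  perm_eq S R -> reducible E0 a b c v m S -> reducible E0 a b c v m R.
Proof.
move=> eqSR [[r le_r pnS]|[r le_r pnS]]; [left|right]; exists r => // k /pnS.
  by apply: pn_perm; rewrite perm_cat2r.
by apply: pn_perm; rewrite perm_cat2r.
Qed.

Ltac perm_hyps :=
  let A := fresh "A" in apply/permP => A;
  repeat match goal with H : is_true (perm_eq _ _) |- _ => move: (permP H A); clear H end;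
  rewrite /= ?count_cat /= ?count_cat /=; count_lia.

Lemma clip_size a b c X S : clip a b c X S -> size X = 3.
Proof. by case=> w [u [v [/perm_size-> _]]]. Qed.

Lemma is_clip_size a b c X S : is_clip a b c X S -> size X = 3.
Proof. by case=> /clip_size. Qed.

Lemma is_clipped_size a b c X S : is_clipped a b c X S -> size X = 4.
Proof.
by case=> y [Y [R [/perm_size-> _ [[]|[]|[]] /clip_size /= ->]]].
Qed.

Ltac size_tac :=
  repeat match goal with
  | H : stub 2 _ _ _ _ _ |- _ => move: (is_clip_size H); clear H
  | H : stub 3 _ _ _ _ _ |- _ => move: (is_clipped_size H); clear H
  | H : clip _ _ _ _ _ |- _ => move: (clip_size H); clear H
  | H : is_true (perm_eq ?X _) |- _ => move: (perm_size H); clear H end;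
  rewrite /= ?size_cat /=; clear; lia.

Lemma node_sorted E0 a b c v n1 n2 n3 X1 X2 X3 S1 S2 S3 :
  let X := v :: X1 ++ X2 ++ X3 in let S := star v a b c ++ S1 ++ S2 ++ S3 in
  tri E0 a b c -> uniq X -> all (fresh E0) X -> n3 <= n2 <= n1 ->
  stub n1 v a b X1 S1 -> stub n2 v a c X2 S2 -> stub n3 v b c X3 S3 ->
  (exists n, stub n a b c X S) \/ reducible E0 a b c v (size X) S.
Proof.
move=> X S tri0 X_uniq X_fr; have /= /andP[fr_v _] := X_fr.
have nw : fresh_verts E0 v (X1 ++ X2 ++ X3) by apply/andP.
have nwP Y : perm_eq (X1 ++ X2 ++ X3) Y -> fresh_verts E0 v Y by move/fresh_verts_perm<-.
have [t1 t2 t3] := tri_star3 tri0 fr_v.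
have frY Y x : fresh_verts E0 v Y -> x \in Y -> fresh (star v a b c ++ E0) x.
  exact: fresh_verts_inside.
have red m R : reducible E0 a b c v m R -> m = size X -> perm_eq R S ->
    (exists n, stub n a b c X S) \/ reducible E0 a b c v (size X) S.
  by move=> redR <- eqR; right; apply: reducible_perm eqR redR.
rewrite /X /S {X S X_uniq X_fr} in red *.
move=> le_n s1 s2 s3; move: le_n.
have n1_lt4 : n1 < 4 by case: n1 s1 => [|[|[|[|n1]]]].
case: n1 n1_lt4 s1 => [|[|[|[|//]]]] _ s1; case: n2 s2 => [|[|[|[|n2]]]] s2 //;
  case: n3 s3 => [|[|[|[|n3]]]] s3 // _.
- case: s1 s2 s3 => -> -> [-> ->] [-> ->]; left; by exists 1, v.
- case: s1 => y [defX eqS]; case: s2 s3 => defX2 defS2 [defX3 defS3]; subst.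
  have nw' : fresh_verts E0 v [:: y] by apply: nwP; perm_hyps.
  by apply: red (red_LEE tri0 nw') _ _ => //; perm_hyps.
- case: s1 => y [defX eqS]; case: s2 => y' [defX2 eqS2]; case: s3 => defX3 defS3; subst.
  left; exists 2; constructor 1; exists v, y, y'; split=> //.
  by rewrite /clip_edges; perm_hyps.
- case: s1 => x [defX eqS]; case: s2 => y [defX2 eqS2]; case: s3 => z [defX3 eqS3]; subst.
  have nw' : fresh_verts E0 v [:: x; y; z] by apply: nwP; perm_hyps.
  by apply: red (red_LLL tri0 fr_v nw') _ _ => //; perm_hyps.
- case: s2 s3 => defX2 defS2 [defX3 defS3]; subst; case: s1 => cl.
  + have att : attach (star v a b c ++ E0) v X1 S1 by exists a, b.
    have nw' : fresh_verts E0 v (X1 ++ [::]) by apply: nwP; perm_hyps.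
    by apply: red (red_BEE tri0 fr_v nw' att) _ _; [size_tac | perm_hyps].
  + left; exists 3, v, X1, S1; rewrite !cats0; split=> //.
    by constructor 1; left; apply: clipC.
  + left; exists 3, v, X1, S1; rewrite !cats0; split=> //.
    by constructor 2; left; apply: clipC.
- case: s2 => y [defX eqS]; case: s3 => defX3 defS3; subst.
  have [z _ att] := is_clip_attach s1.
  have nw' : fresh_verts E0 v (y :: X1 ++ [::]) by apply: nwP; perm_hyps.
  by apply: red (red_BLE tri0 nw' (att _ t1)) _ _; [size_tac | perm_hyps].
- case: s2 => x [defX eqS2]; case: s3 => y [defX3 eqS3]; subst.
  have [w [Y [R [o1 [o2 [eqX eqS o1in o2in wg]]]]]] := is_clip_wing s1.
  have nw' : fresh_verts E0 v [:: w, x, y & Y ++ [::]] by apply: nwP; perm_hyps.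
  have fr_w := frY _ w nw' (mem_head _ _).
  by apply: red (red_BLL tri0 fr_v nw' (wg _ t1 fr_w) o1in o2in) _ _; [size_tac | perm_hyps].
- case: s3 => defX3 defS3; subst.
  have nw' : fresh_verts E0 v (X1 ++ X2 ++ [::]) by apply: nwP; perm_hyps.
  by apply: red (red_BBE tri0 fr_v nw' s1 s2) _ _; [size_tac | perm_hyps].
- case: s3 => y [defX3 eqS3]; subst.
  have nw' : fresh_verts E0 v (y :: X1 ++ X2 ++ [::]) by apply: nwP; perm_hyps.
  by apply: red (red_BBL tri0 fr_v nw' s1 s2) _ _; [size_tac | perm_hyps].
- have [z2 z2in att2] := is_clip_attach s2; have [z3 z3in att3] := is_clip_attach s3.
  have nw' : fresh_verts E0 v (X1 ++ X2 ++ X3 ++ [::]) by apply: nwP; perm_hyps.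
  by apply: red (red_BBB tri0 fr_v nw' s1 z2in (att2 _ t2) z3in (att3 _ t3)) _ _;
    [size_tac | perm_hyps].
- case: s2 s3 => defX2 defS2 [defX3 defS3]; subst.
  have [y [Y [R [eqX eqS [z zin att]]]]] := is_clipped_attach s1.
  have nw' : fresh_verts E0 v (y :: Y ++ [::]) by apply: nwP; perm_hyps.
  have fr_y := frY _ y nw' (mem_head _ _).
  by apply: red (red_CEE tri0 nw' (att _ t1 fr_y)) _ _; [size_tac | perm_hyps].
- case: s2 => l [defX2 eqS2]; case: s3 => defX3 defS3; subst.
  have [y [Y [R [eqX eqS [z zin att]]]]] := is_clipped_attach s1.
  have nw' : fresh_verts E0 v [:: y, l & Y ++ [::]] by apply: nwP; perm_hyps.
  have fr_y := frY _ y nw' (mem_head _ _).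
  by apply: red (red_CLE tri0 fr_v nw' zin (att _ t1 fr_y)) _ _; [size_tac | perm_hyps].
- case: s2 => x [defX2 eqS2]; case: s3 => l [defX3 eqS3]; subst.
  have [y [Y [R [eqX eqS [z zin att]]]]] := is_clipped_attach s1.
  have nw' : fresh_verts E0 v [:: y, x, l & Y ++ [::]] by apply: nwP; perm_hyps.
  have fr_y := frY _ y nw' (mem_head _ _).
  by apply: red (red_CLL tri0 fr_v nw' zin (att _ t1 fr_y)) _ _; [size_tac | perm_hyps].
- case: s3 => defX3 defS3; subst.
  have [y [Y [R [eqX eqS [z zin att]]]]] := is_clipped_attach s1.
  have [z2 z2in att2] := is_clip_attach s2.
  have nw' : fresh_verts E0 v (y :: Y ++ X2 ++ [::]) by apply: nwP; perm_hyps.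
  have fr_y := frY _ y nw' (mem_head _ _).
  by apply: red (red_CBE tri0 fr_v nw' zin (att _ t1 fr_y) z2in (att2 _ t2)) _ _;
    [size_tac | perm_hyps].
- case: s3 => l [defX3 eqS3]; subst.
  have [y [Y [R [eqX eqS [z zin att]]]]] := is_clipped_attach s1.
  have [w [Y2 [R2 [o1 [o2 [eqX2 eqS2 o1in o2in wg]]]]]] := is_clip_wing s2.
  have nw' : fresh_verts E0 v [:: y, w, l & Y2 ++ Y ++ [::]] by apply: nwP; perm_hyps.
  have fr_y := frY _ y nw' (mem_head _ _).
  have fr_w : fresh (star v a b c ++ E0) w by apply: frY nw' _; rewrite !inE eqxx orbT.
  by apply: red (red_CBL tri0 fr_v nw' (att _ t1 fr_y) (wg _ t2 fr_w) o1in o2in) _ _;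
    [size_tac | perm_hyps].
- have [y [Y [R [eqX eqS [z zin att]]]]] := is_clipped_attach s1.
  have [z2 z2in att2] := is_clip_attach s2; have [z3 z3in att3] := is_clip_attach s3.
  have nw' : fresh_verts E0 v (y :: Y ++ X2 ++ X3 ++ [::]) by apply: nwP; perm_hyps.
  have fr_y := frY _ y nw' (mem_head _ _).
  by apply: red (red_CBB tri0 fr_v nw' zin (att _ t1 fr_y) z2in (att2 _ t2) z3in (att3 _ t3)) _ _;
    [size_tac | perm_hyps].
- case: s3 => defX3 defS3; subst.
  have [y [Y [R [eqX eqS [z zin att]]]]] := is_clipped_attach s1.
  have [y2 [Y2 [R2 [eqX2 eqS2 [z2 z2in att2]]]]] := is_clipped_attach s2.
  have nw' : fresh_verts E0 v [:: y, y2 & Y ++ Y2 ++ [::]] by apply: nwP; perm_hyps.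
  have fr_y := frY _ y nw' (mem_head _ _).
  have fr_y2 : fresh (star v a b c ++ E0) y2 by apply: frY nw' _; rewrite !inE eqxx orbT.
  by apply: red (red_CCE tri0 fr_v nw' zin (att _ t1 fr_y) z2in (att2 _ t2 fr_y2)) _ _;
    [size_tac | perm_hyps].
- case: s3 => l [defX3 eqS3]; subst.
  have [y [Y [R [eqX eqS [z zin att]]]]] := is_clipped_attach s1.
  have [y2 [Y2 [R2 [eqX2 eqS2 [z2 z2in att2]]]]] := is_clipped_attach s2.
  have nw' : fresh_verts E0 v [:: y, y2, l & Y ++ Y2 ++ [::]] by apply: nwP; perm_hyps.
  have fr_y := frY _ y nw' (mem_head _ _).
  have fr_y2 : fresh (star v a b c ++ E0) y2 by apply: frY nw' _; rewrite !inE eqxx orbT.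
  by apply: red (red_CCL tri0 fr_v nw' (att _ t1 fr_y) (att2 _ t2 fr_y2)) _ _;
    [size_tac | perm_hyps].
- have [y [Y [R [eqX eqS [z zin att]]]]] := is_clipped_attach s1.
  have [y2 [Y2 [R2 [eqX2 eqS2 [z2 z2in att2]]]]] := is_clipped_attach s2.
  have [z3 z3in att3] := is_clip_attach s3.
  have nw' : fresh_verts E0 v [:: y, y2 & Y ++ Y2 ++ X3 ++ [::]] by apply: nwP; perm_hyps.
  have fr_y := frY _ y nw' (mem_head _ _).
  have fr_y2 : fresh (star v a b c ++ E0) y2 by apply: frY nw' _; rewrite !inE eqxx orbT.
  by apply: red (red_CCB tri0 fr_v nw' zin (att _ t1 fr_y) z2in (att2 _ t2 fr_y2)
    z3in (att3 _ t3)) _ _; [size_tac | perm_hyps].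
- have [y [Y [R [eqX eqS [z zin att]]]]] := is_clipped_attach s1.
  have [y2 [Y2 [R2 [eqX2 eqS2 [z2 z2in att2]]]]] := is_clipped_attach s2.
  have [y3 [Y3 [R3 [eqX3 eqS3 [z3 z3in att3]]]]] := is_clipped_attach s3.
  have nw' : fresh_verts E0 v [:: y, y2, y3 & Y ++ Y2 ++ Y3 ++ [::]] by apply: nwP; perm_hyps.
  have fr_y := frY _ y nw' (mem_head _ _).
  have fr_y2 : fresh (star v a b c ++ E0) y2 by apply: frY nw' _; rewrite !inE eqxx orbT.
  have fr_y3 : fresh (star v a b c ++ E0) y3 by apply: frY nw' _; rewrite !inE eqxx !orbT.
  by apply: red (red_CCC tri0 fr_v nw' (att _ t1 fr_y) (att2 _ t2 fr_y2) (att3 _ t3 fr_y3)) _ _;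
    [size_tac | perm_hyps].
Qed.

Lemma is_clip_swap12 a b c X S : is_clip a b c X S -> is_clip b a c X S.
Proof. by case=> cl; [constructor 2|constructor 1|constructor 3; apply: clipC]. Qed.

Lemma is_clip_swap23 a b c X S : is_clip a b c X S -> is_clip a c b X S.
Proof. by case=> cl; [constructor 1; apply: clipC|constructor 3|constructor 2]. Qed.

Lemma stub_swap12 n a b c X S : stub n a b c X S -> stub n b a c X S.
Proof.
case: n => [|[|[|[|n]]]]; [exact: id | | | | by case].
- by case=> v [-> eqS]; exists v; split; rewrite ?(permPl eqS) //; perm_edges.
- exact: is_clip_swap12.
- case=> y [Y [R [eqX eqS cl]]]; exists y, Y, R; split; first exact: eqX.
    by rewrite (permPl eqS) perm_cat2r; perm_edges.
  case: cl => -[] cl; [constructor 2; left|constructor 2; right|constructor 1; left|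
    constructor 1; right|constructor 3; right|constructor 3; left]; exact: cl.
Qed.

Lemma stub_swap23 n a b c X S : stub n a b c X S -> stub n a c b X S.
Proof.
case: n => [|[|[|[|n]]]]; [exact: id | | | | by case].
- by case=> v [-> eqS]; exists v; split; rewrite ?(permPl eqS) //; perm_edges.
- exact: is_clip_swap23.
- case=> y [Y [R [eqX eqS cl]]]; exists y, Y, R; split; first exact: eqX.
    by rewrite (permPl eqS) perm_cat2r; perm_edges.
  case: cl => -[] cl; [constructor 1; right|constructor 1; left|constructor 3; left|
    constructor 3; right|constructor 2; left|constructor 2; right]; exact: cl.
Qed.

Lemma stub_perm n a b c X Y S R :
  perm_eq X Y -> perm_eq S R -> stub n a b c X S -> stub n a b c Y R.
Proof.
have clip_perm x y z : perm_eq X Y -> perm_eq S R -> clip x y z X S -> clip x y z Y R.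
  by move=> eqXY eqSR [w [u [v []]]]; rewrite (permPl eqXY) (permPl eqSR); exists w, u, v.
move=> eqXY eqSR; case: n => [|[|[|[|n]]]] //=.
- case=> defX defS; move: eqXY eqSR; rewrite defX defS !(perm_sym [::]).
  by move=> /perm_nilP-> /perm_nilP->.
- case=> v [defX eqS]; exists v; rewrite -(permPl eqSR); split=> //.
  by apply: perm_small_eq => //; rewrite perm_sym -defX.
- by case=> /clip_perm cl; [constructor 1|constructor 2|constructor 3]; apply: cl.
- by case=> y [X' [S']]; rewrite (permPl eqXY) (permPl eqSR); exists y, X', S'.
Qed.

Definition outcome E0 a b c v X S :=
  (exists n, stub n a b c X S) \/ reducible E0 a b c v (size X) S.

Lemma reducible_sym E0 a b c a' b' c' v m S :
  [|| par E0 a, par E0 b | par E0 c] = [|| par E0 a', par E0 b' | par E0 c'] ->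
  perm_eq (star v a b c) (star v a' b' c') ->
  reducible E0 a b c v m S -> reducible E0 a' b' c' v m S.
Proof.
move=> eq_ev eq_st [[r le_r pnS]|[r le_r pnS]]; [left|right]; exists r => //.
  by move: le_r; rewrite /all_even eq_ev.
by move=> k pn1; apply: pnS; apply: pn_perm pn1; rewrite perm_cat2r perm_sym.
Qed.

Lemma outcome_perm E0 a b c v X Y S R : perm_eq X Y -> perm_eq S R ->
  outcome E0 a b c v X S -> outcome E0 a b c v Y R.
Proof.
move=> eqXY eqSR [[n smX]|red]; [left|right]; first by exists n; apply: stub_perm smX.
by rewrite -(perm_size eqXY); apply: reducible_perm red.
Qed.

Lemma outcome_swap12 E0 a b c v X S : outcome E0 a b c v X S -> outcome E0 b a c v X S.
Proof.
case=> [[n smX]|red]; [left|right]; first by exists n; apply: stub_swap12.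
by apply: reducible_sym red; [rewrite orbCA|perm_edges].
Qed.

Lemma outcome_swap23 E0 a b c v X S : outcome E0 a b c v X S -> outcome E0 a c b v X S.
Proof.
case=> [[n smX]|red]; [left|right]; first by exists n; apply: stub_swap23.
by apply: reducible_sym red; [rewrite (orbC (par E0 c))|perm_edges].
Qed.

Lemma node_outcome E0 a b c v n1 n2 n3 X1 X2 X3 S1 S2 S3 :
  let X := v :: X1 ++ X2 ++ X3 in let S := star v a b c ++ S1 ++ S2 ++ S3 in
  tri E0 a b c -> uniq X -> all (fresh E0) X ->
  stub n1 v a b X1 S1 -> stub n2 v a c X2 S2 -> stub n3 v b c X3 S3 ->
  outcome E0 a b c v X S.
Proof.
have max1 a' b' c' m1 m2 m3 Y1 Y2 Y3 R1 R2 R3 :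
    let X := v :: Y1 ++ Y2 ++ Y3 in let S := star v a' b' c' ++ R1 ++ R2 ++ R3 in
    m2 <= m1 -> m3 <= m1 -> tri E0 a' b' c' -> uniq X -> all (fresh E0) X ->
    stub m1 v a' b' Y1 R1 -> stub m2 v a' c' Y2 R2 -> stub m3 v b' c' Y3 R3 ->
    outcome E0 a' b' c' v X S.
  move=> X S le21 le31 tri0 X_uniq X_fr s1 s2 s3; case: (leqP m3 m2) => [le32|/ltnW le23].
    by apply: node_sorted s1 s2 s3; rewrite ?le32.
  have eqX : perm_eq X (v :: Y1 ++ Y3 ++ Y2).
    by rewrite perm_cons perm_cat2l perm_catC.
  apply: outcome_swap12; apply: (outcome_perm (X := v :: Y1 ++ Y3 ++ Y2)
      (S := star v b' a' c' ++ R1 ++ R3 ++ R2)).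
  - by rewrite perm_sym.
  - by perm_edges.
  apply: node_sorted _ _ _ _ (stub_swap23 s1) s3 s2.
  - by rewrite tri_swap12.
  - by rewrite -(perm_uniq eqX).
  - by rewrite -(perm_all _ eqX).
  - by rewrite le23.
move=> X S tri0 X_uniq X_fr s1 s2 s3.
have to3 : n1 <= n3 -> n2 <= n3 -> outcome E0 a b c v X S.
  move=> le13 le23; have eqX : perm_eq X (v :: X3 ++ X2 ++ X1).
    by apply/permP=> A; rewrite /= !count_cat; count_lia.
  apply/outcome_swap12/outcome_swap23/outcome_swap12.
  apply: (outcome_perm (X := v :: X3 ++ X2 ++ X1)
      (S := star v c b a ++ S3 ++ S2 ++ S1)).
  - by rewrite perm_sym.
  - by perm_edges.
  apply: max1 le23 le13 _ _ _ (stub_swap23 s3) (stub_swap23 s2) (stub_swap23 s1).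
  - by rewrite tri_swap12 tri_swap23 tri_swap12.
  - by rewrite -(perm_uniq eqX).
  - by rewrite -(perm_all _ eqX).
case: (leqP n2 n1) => [le21|/ltnW le12].
  case: (leqP n3 n1) => [le31|/ltnW le13]; first exact: max1 s1 s2 s3.
  exact: to3 le13 (leq_trans le21 le13).
case: (leqP n3 n2) => [le32|/ltnW le23]; last exact: to3 (leq_trans le12 le23) le23.
have eqX : perm_eq X (v :: X2 ++ X1 ++ X3) by rewrite perm_cons perm_catCA.
apply: outcome_swap23; apply: (outcome_perm (X := v :: X2 ++ X1 ++ X3)
    (S := star v a c b ++ S2 ++ S1 ++ S3)).
- by rewrite perm_sym.
- by perm_edges.
apply: max1 le12 le32 _ _ _ s2 s1 (stub_swap23 s3).
- by rewrite tri_swap23.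
- by rewrite -(perm_uniq eqX).
- by rewrite -(perm_all _ eqX).
Qed.
End Dispatch.

(** [Face] is a face in which nothing is stacked. *)
Inductive tree (T : Type) := Face | Stack of T & tree T & tree T & tree T.
Arguments Face {T}.

Section Trees.
Variable T : finType.
Implicit Types (a b c v x : T) (X Y : seq T) (E S R : seq {set T}) (t : tree T).

Fixpoint tree_verts t :=
  if t is Stack v t1 t2 t3 then v :: tree_verts t1 ++ tree_verts t2 ++ tree_verts t3 else [::].

Fixpoint tree_edges a b c t :=
  if t is Stack v t1 t2 t3
  then star v a b c ++ tree_edges v a b t1 ++ tree_edges v a c t2 ++ tree_edges v b c t3
  else [::].

Lemma fresh_tree_edges a b c t x :
  x \notin [:: a; b; c] -> x \notin tree_verts t -> fresh (tree_edges a b c t) x.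
Proof.
elim: t a b c => [|v t1 IH1 t2 IH2 t3 IH3] a b c; first by [].
rewrite !(inE, mem_cat) !negb_or => /and3P[xa xb xc] /and4P[xv xt1 xt2 xt3].
by rewrite !fresh_cat fresh_star IH1 ?IH2 ?IH3 ?xv ?xa ?xb ?xc // !inE !negb_or ?xv ?xa ?xb ?xc.
Qed.

Lemma fresh_tri_notin E a b c x : tri E a b c -> fresh E x -> x \notin [:: a; b; c].
Proof. by move=> triE /(fresh_tri triE)/and3P[xa xb xc]; rewrite !inE !negb_or xa xb. Qed.

Definition is_face t := if t is Face then true else false.

(** The bound of [reducible], for a subtree anywhere in the tree. *)
Definition shrinks E a b c t := exists t' r,
  [/\ subseq (tree_verts t') (tree_verts t), size (tree_verts t') < size (tree_verts t),
    8 * r + 5 * size (tree_verts t') + (is_face t' && all_even E a b c) <= 5 * size (tree_verts t) &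
    forall k, pn (tree_edges a b c t' ++ E) k -> pn (tree_edges a b c t ++ E) (k + r)].

(** If a subtree shrinks then so does the tree, with the other subtrees as part of
    the surrounding graph; and if all three subtrees are stubs, [node_outcome]
    applies. *)
Lemma tree_reduce t E a b c :
  tri E a b c -> uniq (tree_verts t) -> all (fresh E) (tree_verts t) ->
  (exists n, stub n a b c (tree_verts t) (tree_edges a b c t)) \/ shrinks E a b c t.
Proof.
elim: t E a b c => [|v t1 IH1 t2 IH2 t3 IH3] E a b c triE; first by left; exists 0.
move=> X_uniq X_fr; pose X := tree_verts t1 ++ tree_verts t2 ++ tree_verts t3.
have [v_notin uniq_t] : v \notin X /\ uniq X by apply/andP.
have [fr_v fr_t] : fresh E v /\ all (fresh E) X by apply/andP.
rewrite {}/X in v_notin uniq_t fr_t.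
have [tri1 tri2 tri3] := tri_star3 triE fr_v.
have fr_x x : x \in tree_verts t1 ++ tree_verts t2 ++ tree_verts t3 ->
    fresh (star v a b c ++ E) x /\ x \notin [:: v; a; b; c].
  move=> t_x; have fr_x := allP fr_t x t_x.
  have neq_xv : x != v by apply: contraNneq v_notin => <-.
  by rewrite fresh_cat (fresh_star_tri triE) // inE negb_or neq_xv (fresh_tri_notin triE).
have fr_sub x p q r t : x \in tree_verts t1 ++ tree_verts t2 ++ tree_verts t3 ->
    x \notin tree_verts t ->
    {subset [:: p; q; r] <= [:: v; a; b; c]} -> fresh (tree_edges p q r t) x.
  move=> /fr_x[_ x_out] xt sub_pqr; apply: fresh_tree_edges => //.
  by apply: contra x_out => /sub_pqr.
move: (uniq_t); rewrite !cat_uniq has_cat negb_or.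
case/and3P=> uniq1 /andP[/hasPn dis12 /hasPn dis13] /and3P[uniq2 /hasPn dis23 uniq3].
pose E1 := star v a b c ++ E.
have descend t0 p q r R mk m :
    (forall E a b c, tri E a b c -> uniq (tree_verts t0) -> all (fresh E) (tree_verts t0) ->
       (exists n, stub n a b c (tree_verts t0) (tree_edges a b c t0)) \/ shrinks E a b c t0) ->
    tri E1 p q r -> uniq (tree_verts t0) -> all (fresh (R ++ E1)) (tree_verts t0) ->
    (forall t', perm_eq (tree_edges a b c (mk t')) (tree_edges p q r t' ++ R ++ star v a b c)) ->
    (forall t', subseq (tree_verts t') (tree_verts t0) ->
       subseq (tree_verts (mk t')) (tree_verts (mk t0))) ->
    (forall t', size (tree_verts (mk t')) = size (tree_verts t') + m /\ ~~ is_face (mk t')) ->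
    (exists n, stub n p q r (tree_verts t0) (tree_edges p q r t0)) \/ shrinks E a b c (mk t0).
  move=> IH tri_pqr uniq0 fr0 edges_mk sub_mk size_mk.
  have {tri_pqr} tri_pqr : tri (R ++ E1) p q r.
    by apply: tri_sub tri_pqr => e Ee; rewrite mem_cat Ee orbT.
  case: (IH _ _ _ _ tri_pqr uniq0 fr0) => [?|[t' [n [sub_t' lt_t' le_n pn_t']]]]; [by left|right].
  have [sz0 _] := size_mk t0; have [sz' /negPf leaf'] := size_mk t'.
  exists (mk t'), n; split; first exact: sub_mk.
  - by rewrite sz0 sz' ltn_add2r.
  - by move: le_n; rewrite sz0 sz' leaf' /=; clear; lia.
  have eq_mk t'' : perm_eq (tree_edges p q r t'' ++ R ++ E1) (tree_edges a b c (mk t'') ++ E).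
    by rewrite perm_sym /E1 (permPl (perm_cat (edges_mk t'') (perm_refl E))) -!catA.
  by move=> k pnk; apply: pn_perm (eq_mk t0) _; apply: pn_t'; apply: pn_perm pnk; rewrite perm_sym.
have in1 x : x \in tree_verts t1 -> x \in tree_verts t1 ++ tree_verts t2 ++ tree_verts t3.
  by rewrite !mem_cat => ->.
have in2 x : x \in tree_verts t2 -> x \in tree_verts t1 ++ tree_verts t2 ++ tree_verts t3.
  by rewrite !mem_cat => ->; rewrite orbT.
have in3 x : x \in tree_verts t3 -> x \in tree_verts t1 ++ tree_verts t2 ++ tree_verts t3.
  by rewrite !mem_cat => ->; rewrite !orbT.
have sub_ab : {subset [:: v; a; b] <= [:: v; a; b; c]} by sub_tac.
have sub_ac : {subset [:: v; a; c] <= [:: v; a; b; c]} by sub_tac.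
have sub_bc : {subset [:: v; b; c] <= [:: v; a; b; c]} by sub_tac.
have [[n1 s1]|] : (exists n, stub n v a b (tree_verts t1) (tree_edges v a b t1))
    \/ shrinks E a b c (Stack v t1 t2 t3); last by right.
  apply: (descend t1 v a b (tree_edges v a c t2 ++ tree_edges v b c t3)
    (fun t => Stack v t t2 t3) (size (tree_verts t2 ++ tree_verts t3)).+1 IH1) => //.
  - apply/allP=> x x1; have [fr1 _] := fr_x x (in1 x x1); rewrite fresh_cat fr1 andbT fresh_cat.
    by rewrite !fr_sub ?in1 //; apply: contraL x1; first [exact: dis12 | exact: dis13].
  - by move=> t'; rewrite /=; perm_edges.
  - by move=> t' sub_t'; rewrite /= eqxx; apply: cat_subseq.
  - by move=> t'; rewrite /= !size_cat; split=> //; clear; lia.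
have [[n2 s2]|] : (exists n, stub n v a c (tree_verts t2) (tree_edges v a c t2))
    \/ shrinks E a b c (Stack v t1 t2 t3); last by right.
  apply: (descend t2 v a c (tree_edges v a b t1 ++ tree_edges v b c t3)
    (fun t => Stack v t1 t t3) (size (tree_verts t1 ++ tree_verts t3)).+1 IH2) => //.
  - apply/allP=> x x2; have [fr1 _] := fr_x x (in2 x x2); rewrite fresh_cat fr1 andbT fresh_cat.
    by rewrite !fr_sub ?in2 //; first [exact: dis12 | apply: contraL x2; exact: dis23].
  - by move=> t'; rewrite /=; perm_edges.
  - by move=> t' sub_t'; rewrite /= eqxx; do ?apply: cat_subseq.
  - by move=> t'; rewrite /= !size_cat; split=> //; clear; lia.
have [[n3 s3]|] : (exists n, stub n v b c (tree_verts t3) (tree_edges v b c t3))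
    \/ shrinks E a b c (Stack v t1 t2 t3); last by right.
  apply: (descend t3 v b c (tree_edges v a b t1 ++ tree_edges v a c t2)
    (fun t => Stack v t1 t2 t) (size (tree_verts t1 ++ tree_verts t2)).+1 IH3) => //.
  - apply/allP=> x x3; have [fr1 _] := fr_x x (in3 x x3); rewrite fresh_cat fr1 andbT fresh_cat.
    by rewrite !fr_sub ?in3 //; first [exact: dis23 | exact: dis13].
  - by move=> t'; rewrite /=; perm_edges.
  - by move=> t' sub_t'; rewrite /= eqxx; do ?apply: cat_subseq.
  - by move=> t'; rewrite /= !size_cat; split=> //; clear; lia.
case: (node_outcome triE X_uniq X_fr s1 s2 s3);
  [by left | case=> [[r le_r pnr]|[r /andP[r_gt0 le_r] pnr]]].
  right; exists Face, r; split=> //.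
  by move: le_r; rewrite /= !size_cat; clear; case: (all_even _ _ _ _) => /=; lia.
right; exists (Stack v Face Face Face), r; split; rewrite /= ?eqxx //.
- exact: sub0seq.
- by move: r_gt0 le_r; rewrite /= -/(tree_verts t1) -/(tree_verts t2) -/(tree_verts t3); clear; lia.
- by move: r_gt0 le_r; rewrite /= -/(tree_verts t1) -/(tree_verts t2) -/(tree_verts t3); clear; lia.
Qed.

(** * The bound for trees *)

Definition triangle a b c := [:: edge a b; edge a c; edge b c].

Lemma tri_triangle a b c : uniq [:: a; b; c] -> tri (triangle a b c) a b c.
Proof. by move=> uniq_abc; rewrite /tri uniq_abc !inE !eqxx !orbT. Qed.

Lemma fresh_triangle a b c x : fresh (triangle a b c) x = (x \notin [:: a; b; c]).
Proof.
rewrite /triangle !fresh_cons fresh_nil !in_edge !inE !negb_or.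
by case: (x == a); case: (x == b); case: (x == c).
Qed.

Lemma par_triangle a b c x : uniq [:: a; b; c] -> par (triangle a b c) x = false.
Proof.
rewrite /par /deg /= !in_edge !inE negb_or andbT => /andP[/andP[ab ac] bc].
case: (eqVneq x a) => [->|_]; first by rewrite (negPf ab) (negPf ac).
case: (eqVneq x b) => [->|_]; first by rewrite (negPf bc).
by case: (x == c).
Qed.

(** All four vertices of [K4] are odd, so that a clip or a wing added to it costs
    one path. *)
Lemma stage_K4 a b c v X : uniq ([:: a; b; c] ++ v :: X) ->
  stage [:: a; b; c] (star v a b c ++ triangle a b c) X 2 (fun=> true).
Proof.
rewrite cat_uniq => /and3P[uniq_abc /hasPn out /andP[v_notin X_uniq]].
have v_out : v \notin [:: a; b; c] by apply: out; rewrite mem_head.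
have tri0 := tri_triangle uniq_abc.
split=> //; last 1 first.
- move=> x abc_x; have neq_xv : x != v by apply: contraNneq v_out => <-.
  rewrite fresh_cat negb_and (tri_fresh tri0 abc_x) orbT; split=> //.
  rewrite par_cat par_triangle // addbF par_star //.
  case/and3P: uniq_abc; rewrite !inE negb_or => /andP[ab ac] bc _.
  move: abc_x; rewrite !inE => /or3P[]/eqP->;
    by rewrite eqxx ?(eq_sym b a) ?(eq_sym c) ?(negPf ab) ?(negPf ac) ?(negPf bc).
- move: uniq_abc v_out; rewrite /= !inE !negb_or andbT => uniq_abc v_out; conj_hyps.
  have pn0 : pn (T := T) [::] 0 by exists [::].
  apply: pn_perm (pn_path (p := [:: a; b; c; v]) _ (pn_path (p := [:: c; a; v; b]) _ pn0)).
  + by rewrite /triangle; perm_edges.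
  + by conj_goal.
  + by conj_goal.
apply/allP=> x Xx; rewrite fresh_cat fresh_triangle out ?inE ?Xx ?orbT // andbT.
apply: fresh_star_tri tri0 _ _; first by rewrite fresh_triangle out // inE Xx orbT.
by apply: contraNneq v_notin => <-.
Qed.

Lemma stub_bound n a b c X S : uniq ([:: a; b; c] ++ X) -> stub n a b c X S ->
  exists k, pn (S ++ triangle a b c) k /\ 8 * k <= 5 * (3 + size X) + (size X == 0).
Proof.
move=> uniqX; have uniq_abc : uniq [:: a; b; c] by move: uniqX; rewrite cat_uniq => /andP[].
case: n => [|[|[|[|n]]]]; last by case.
- case=> -> ->; exists 2; split=> //.
  have pn0 : pn (T := T) [::] 0 by exists [::].
  move: uniq_abc; rewrite /= !inE !negb_or andbT => uniq_abc; conj_hyps.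
  apply: pn_perm (pn_path (p := [:: a; b; c]) _ (pn_path (p := [:: a; c]) _ pn0)).
  + by rewrite /triangle; perm_edges.
  + by conj_goal.
  + by conj_goal.
- case=> v [defX eqS]; exists 2; rewrite defX in uniqX *; split=> //.
  apply: pn_stage (stage_K4 uniqX) _ _ => //.
  by rewrite perm_cat2r perm_sym.
- move=> clipX; exists 3; rewrite (is_clip_size clipX); split=> //.
  have [w [Y [R [o1 [o2 [eqX eqS o1in o2in wg]]]]]] := is_clip_wing clipX.
  have uniqY : uniq ([:: a; b; c] ++ w :: (Y ++ [::])).
    by rewrite cats0 -(perm_uniq (perm_cat (perm_refl [:: a; b; c]) eqX)).
  have tri0 := tri_triangle uniq_abc.
  have fr_w : fresh (triangle a b c) w.
    rewrite fresh_triangle; move: uniqY; rewrite cat_uniq => /and3P[_ /hasPn out _].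
    by apply: out; rewrite mem_head.
  apply: pn_stage (step_wing (wg _ tri0 fr_w) o1in o2in (stage_K4 uniqY)) _ _ => //.
  by rewrite catA perm_cat2r perm_catC perm_sym.
move=> clippedX; exists 3; rewrite (is_clipped_size clippedX); split=> //.
have [y [Y [R [eqX eqS [z zin att]]]]] := is_clipped_attach clippedX.
have uniqY : uniq ([:: a; b; c] ++ y :: (Y ++ [::])).
  by rewrite cats0 -(perm_uniq (perm_cat (perm_refl [:: a; b; c]) eqX)).
have tri0 := tri_triangle uniq_abc.
have fr_y : fresh (triangle a b c) y.
  rewrite fresh_triangle; move: uniqY; rewrite cat_uniq => /and3P[_ /hasPn out _].
  by apply: out; rewrite mem_head.
apply: pn_stage (step_attach (att _ tri0 fr_y) zin (stage_K4 uniqY)) _ _ => //.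
by rewrite catA perm_cat2r perm_catC perm_sym.
Qed.

Lemma tree_verts_nil t : (size (tree_verts t) == 0) = is_face t.
Proof. by case: t. Qed.

Lemma tree_bound t a b c : uniq ([:: a; b; c] ++ tree_verts t) ->
  exists k, pn (tree_edges a b c t ++ triangle a b c) k /\
    8 * k <= 5 * (3 + size (tree_verts t)) + is_face t.
Proof.
have [n] := ubnP (size (tree_verts t)); elim: n t => // n IHn t lt_t_n uniq_t.
move: (uniq_t); rewrite cat_uniq => /and3P[uniq_abc /hasPn out uniq_X].
have fr_X : all (fresh (triangle a b c)) (tree_verts t).
  by apply/allP=> x /out; rewrite fresh_triangle.
case: (tree_reduce (tri_triangle uniq_abc) uniq_X fr_X) => [[m]|[t' [r [sub_t' lt_t' le_r pn_r]]]].
  by rewrite -tree_verts_nil; apply: stub_bound.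
have [||k [pnk le_k]] := IHn t'.
- exact: leq_trans lt_t' lt_t_n.
- by apply: subseq_uniq uniq_t; apply: cat_subseq.
exists (k + r); split; first exact: pn_r.
move: le_r; rewrite /all_even !par_triangle // andbT; move: le_k; clear.
by case: (is_face t'); case: (is_face t) => /=; lia.
Qed.

(** * Planar 3-trees as trees of stackings *)

Lemma tree_edges_new t a b c (e : {set T}) :
  e \in tree_edges a b c t -> exists2 x, x \in tree_verts t & x \in e.
Proof.
elim: t a b c => [|v t1 IH1 t2 IH2 t3 IH3] a b c //; rewrite !mem_cat => /or4P[].
- by rewrite !inE => /or3P[]/eqP->; exists v; rewrite ?inE ?eqxx.
- by case/IH1 => x xt xe; exists x; rewrite //= inE !mem_cat xt !orbT.
- by case/IH2 => x xt xe; exists x; rewrite //= inE !mem_cat xt !orbT.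
- by case/IH3 => x xt xe; exists x; rewrite //= inE !mem_cat xt !orbT.
Qed.

Lemma uniq_tree_edges_cat t a b c E : uniq (tree_edges a b c t) -> uniq E ->
  all (fresh E) (tree_verts t) -> uniq (tree_edges a b c t ++ E).
Proof.
move=> uniq_t uniqE /allP frE; rewrite cat_uniq uniq_t uniqE andbT.
apply/hasPn=> e Ee; apply/negP=> /tree_edges_new[x /frE /allP/(_ e Ee)].
by move/negP.
Qed.

Lemma uniq_children v t1 t2 t3 a b c :
  uniq ([:: a; b; c] ++ tree_verts (Stack v t1 t2 t3)) ->
  [/\ uniq ([:: v; a; b] ++ tree_verts t1), uniq ([:: v; a; c] ++ tree_verts t2) &
      uniq ([:: v; b; c] ++ tree_verts t3)].
Proof.
move=> uniq_t.
have cut X Y : perm_eq ([:: a; b; c] ++ tree_verts (Stack v t1 t2 t3)) (X ++ Y) -> uniq X.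
  by move=> /perm_uniq; rewrite uniq_t cat_uniq => /esym/andP[].
split; [apply: (cut _ (c :: tree_verts t2 ++ tree_verts t3)) |
  apply: (cut _ (b :: tree_verts t1 ++ tree_verts t3)) |
  apply: (cut _ (a :: tree_verts t1 ++ tree_verts t2))];
  apply/permP=> A; rewrite /= ?count_cat /= ?count_cat /=; count_lia.
Qed.

Lemma uniq_tree_edges t a b c :
  uniq ([:: a; b; c] ++ tree_verts t) -> uniq (tree_edges a b c t).
Proof.
elim: t a b c => [|v t1 IH1 t2 IH2 t3 IH3] a b c //.
move=> /[dup]/uniq_children[uniq_t1 uniq_t2 uniq_t3].
rewrite cat_uniq => /and3P[uniq_abc /hasPn out].
case/andP=> v_notin; have uniq_cat (s1 s2 : seq T) : uniq (s1 ++ s2) ->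
    [/\ uniq s1, {in s2, forall x, x \notin s1} & uniq s2].
  by rewrite cat_uniq => /and3P[? /hasPn ? ?].
case/uniq_cat=> uniq1 dis1 /uniq_cat[uniq2 dis23 uniq3].
have dis12 x : x \in tree_verts t2 -> x \notin tree_verts t1.
  by move=> x2; apply: dis1; rewrite mem_cat x2.
have dis13 x : x \in tree_verts t3 -> x \notin tree_verts t1.
  by move=> x3; apply: dis1; rewrite mem_cat x3 orbT.
have v_out : v \notin [:: a; b; c] by apply: out; rewrite mem_head.
have far x : x \in tree_verts t1 ++ tree_verts t2 ++ tree_verts t3 -> x \notin [:: v; a; b; c].
  move=> tx; rewrite inE negb_or (out x) ?inE ?tx ?orbT // andbT.
  by apply: contraNneq v_notin => <-.
have frT p q t x : {subset [:: p; q] <= [:: a; b; c]} ->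
    x \in tree_verts t1 ++ tree_verts t2 ++ tree_verts t3 ->
    x \notin tree_verts t -> fresh (tree_edges v p q t) x.
  move=> sub_pq /far x_far xt; apply: fresh_tree_edges xt; apply: contra x_far.
  by rewrite in_cons => /predU1P[->|/sub_pq abc_x]; rewrite in_cons ?eqxx ?abc_x ?orbT.
have frS x : x \in tree_verts t1 ++ tree_verts t2 ++ tree_verts t3 -> fresh (star v a b c) x.
  by move/far; rewrite !inE !negb_or fresh_star.
have in1 : {subset tree_verts t1 <= tree_verts t1 ++ tree_verts t2 ++ tree_verts t3}.
  by move=> x; rewrite !mem_cat => ->.
have in2 : {subset tree_verts t2 <= tree_verts t1 ++ tree_verts t2 ++ tree_verts t3}.
  by move=> x; rewrite !mem_cat => ->; rewrite orbT.
have in3 : {subset tree_verts t3 <= tree_verts t1 ++ tree_verts t2 ++ tree_verts t3}.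
  by move=> x; rewrite !mem_cat => ->; rewrite !orbT.
have [ab ac bc] : [/\ {subset [:: a; b] <= [:: a; b; c]}, {subset [:: a; c] <= [:: a; b; c]} &
    {subset [:: b; c] <= [:: a; b; c]}] by split; sub_tac.
have [nab nac nbc] : [/\ a != b, a != c & b != c].
  by move: uniq_abc; rewrite /= !inE negb_or andbT => /andP[/andP[]].
have uniqS : uniq (star v a b c).
  rewrite /= !inE negb_or andbT; apply/andP; split; last first.
    by apply: contra nbc => /eqP/edge_inj->.
  by rewrite (contra _ nab) ?(contra _ nac) // => /eqP/edge_inj->.
suff: uniq (star v a b c ++
    tree_edges v a b t1 ++ tree_edges v a c t2 ++ tree_edges v b c t3) by [].
rewrite uniq_catC -!catA.
apply: uniq_tree_edges_cat.
- exact: IH1.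
- apply: uniq_tree_edges_cat.
  + exact: IH2.
  + apply: uniq_tree_edges_cat => //; first exact: IH3.
    by apply/allP=> x /in3/frS.
  apply/allP=> x x2; rewrite fresh_cat frS ?in2 // frT ?in2 //.
  by apply: contraL x2 => /dis23.
apply/allP=> x x1; rewrite !fresh_cat frS ?in1 // !frT ?in1 //.
  by apply: contraL x1 => /dis13.
by apply: contraL x1 => /dis12.
Qed.

Fixpoint faces a b c t : seq {set T} :=
  if t is Stack v t1 t2 t3
  then faces v a b t1 ++ faces v a c t2 ++ faces v b c t3 else [:: [set a; b; c]].

Lemma perm3_ind (P : T -> T -> T -> Prop) x y z a b c :
  (forall a b c, P a b c -> P b a c) -> (forall a b c, P a b c -> P a c b) ->
  uniq [:: a; b; c] -> {subset [:: a; b; c] <= [:: x; y; z]} -> P x y z -> P a b c.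
Proof.
move=> P12 P23 uniq_abc sub_abc Pxyz; move: uniq_abc.
have: a \in [:: x; y; z] by apply: sub_abc; rewrite mem_head.
have: b \in [:: x; y; z] by apply: sub_abc; rewrite !inE eqxx orbT.
have: c \in [:: x; y; z] by apply: sub_abc; rewrite !inE eqxx !orbT.
rewrite !inE => /or3P[]/eqP-> /or3P[]/eqP-> /or3P[]/eqP->;
  rewrite /= !inE ?eqxx ?orbT ?andbF //= => _.
all: by auto 6.
Qed.

Ltac mem_bools e := repeat match goal with |- context [e \in ?s] => case: (e \in s) end; by [].

(** Faces are compared as sets, so the three corners may come in any order. *)
Lemma stack_tree t x y z a b c v :
  uniq ([:: x; y; z] ++ tree_verts t) -> [set a; b; c] \in faces x y z t ->
  exists t', [/\ perm_eq (tree_verts t') (v :: tree_verts t),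
    tree_edges x y z t' =i star v a b c ++ tree_edges x y z t,
    {subset [:: [set v; a; b]; [set v; a; c]; [set v; b; c]] <= faces x y z t'} &
    forall f, f \in faces x y z t -> f != [set a; b; c] -> f \in faces x y z t'].
Proof.
elim: t x y z => [|w t1 IH1 t2 IH2 t3 IH3] x y z uniq_t.
  rewrite inE => /eqP eq_abc.
  exists (Stack v Face Face Face); rewrite cats0 in uniq_t.
  have eq_mem : [:: x; y; z] =i [:: a; b; c].
    by move=> u; have := congr1 (fun A : {set T} => u \in A) eq_abc; rewrite !inE -!orbA.
  have uniq_abc : uniq [:: a; b; c] by rewrite (uniq_size_uniq uniq_t eq_mem).
  pose P a b c := star v a b c =i star v x y z /\
    {subset [:: [set v; a; b]; [set v; a; c]; [set v; b; c]]
        <= faces x y z (Stack v Face Face Face)}.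
  have [eq_star sub_f] : P a b c.
    apply: (@perm3_ind P x y z) => //.
    - move=> a1 b1 c1 [eq1 sub1]; split=> e.
        by rewrite -eq1 !inE orbCA.
      move=> fe; apply: sub1; move: fe.
      by rewrite !inE (setUAC [set v] [set b1]) (orbC (e == [set v; b1; c1])).
    - move=> a1 b1 c1 [eq1 sub1]; split=> e.
        by rewrite -eq1 !inE (orbC (e == edge v c1)).
      by move=> fe; apply: sub1; move: fe; rewrite !inE (setUAC [set v] [set c1] [set b1]) orbCA.
    - by move=> u; rewrite eq_mem.
    - by split.
  split; [by [] | | exact: sub_f |].
    by move=> e; rewrite [in RHS]cats0 eq_star.
  by move=> f; rewrite inE eq_abc => ->.
have [uniq1 uniq2 uniq3] := uniq_children uniq_t.
have mem_node t1' t2' t3' u : (u \in tree_edges x y z (Stack w t1' t2' t3')) =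
    [|| u \in star w x y z, u \in tree_edges w x y t1', u \in tree_edges w x z t2' |
        u \in tree_edges w y z t3'].
  by rewrite -!mem_cat.
rewrite !mem_cat => /or3P[/(IH1 _ _ _ uniq1)|/(IH2 _ _ _ uniq2)|/(IH3 _ _ _ uniq3)].
- case=> t' [eq_verts eq_edges new_f old_f]; exists (Stack w t' t2 t3); split.
  + by apply/permP=> A; move: (permP eq_verts A); rewrite /= !count_cat /=; count_lia.
  + move=> e; rewrite [in RHS]mem_cat !mem_node eq_edges mem_cat; mem_bools e.
  + by move=> f /new_f; rewrite mem_cat => ->.
  + move=> f; rewrite !mem_cat => /or3P[f_in|f_in|f_in] neq_f; rewrite ?f_in ?orbT //.
    by rewrite old_f.
- case=> t' [eq_verts eq_edges new_f old_f]; exists (Stack w t1 t' t3); split.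
  + by apply/permP=> A; move: (permP eq_verts A); rewrite /= !count_cat /=; count_lia.
  + move=> e; rewrite [in RHS]mem_cat !mem_node eq_edges mem_cat; mem_bools e.
  + by move=> f /new_f; rewrite !mem_cat => ->; rewrite orbT.
  + move=> f; rewrite !mem_cat => /or3P[f_in|f_in|f_in] neq_f; rewrite ?f_in ?orbT //.
    by rewrite old_f // orbT.
- case=> t' [eq_verts eq_edges new_f old_f]; exists (Stack w t1 t2 t'); split.
  + by apply/permP=> A; move: (permP eq_verts A); rewrite /= !count_cat /=; count_lia.
  + move=> e; rewrite [in RHS]mem_cat !mem_node eq_edges mem_cat; mem_bools e.
  + by move=> f /new_f; rewrite !mem_cat => ->; rewrite !orbT.
  + move=> f; rewrite !mem_cat => /or3P[f_in|f_in|f_in] neq_f; rewrite ?f_in ?orbT //.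
    by rewrite old_f // !orbT.
Qed.

Lemma uniq_triangle a b c : uniq [:: a; b; c] -> uniq (triangle a b c).
Proof.
rewrite /= !inE negb_or !andbT => /andP[/andP[ab ac] bc].
rewrite negb_or; apply/andP; split; [apply/andP; split|].
- by apply: contra bc => /eqP/edge_inj->.
- by apply: contra ac; rewrite (edgeC a) => /eqP/edge_inj->.
- by apply: contra ab; rewrite !(edgeC _ c) => /eqP/edge_inj->.
Qed.

Lemma stacked_tree (V : {set T}) (E F : {set {set T}}) : stacked V E F ->
  exists a b c t, [/\ uniq ([:: a; b; c] ++ tree_verts t), [:: a; b; c] ++ tree_verts t =i V,
    tree_edges a b c t ++ triangle a b c =i E & {subset F <= faces a b c t}].
Proof.
elim=> {V E F} [a b c uniq_abc|V E F a b c v _ [x [y [z [t [uniq_t eqV eqE sub_F]]]]] Fabc v_new].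
  exists a, b, c, Face; split=> [|u|e|f]; first by rewrite cats0.
  - by rewrite !inE -!orbA.
  - by rewrite !inE -!orbA.
  - by rewrite !inE.
have [t' [eq_verts eq_edges new_f old_f]] := stack_tree v uniq_t (sub_F _ Fabc).
have eq_xyzt : perm_eq ([:: x; y; z] ++ tree_verts t') (v :: [:: x; y; z] ++ tree_verts t).
  by apply/permP=> A; move: (permP eq_verts A); rewrite /= => ->; count_lia.
exists x, y, z, t'; split=> [|u|e|f].
- by rewrite (perm_uniq eq_xyzt) cons_uniq uniq_t eqV v_new.
- by rewrite (perm_mem eq_xyzt) inE eqV !inE.
- rewrite mem_cat eq_edges mem_cat -orbA -mem_cat eqE in_setU orbC; congr (_ || _).
  by rewrite !inE -!orbA.
rewrite in_setU in_setD1 => /orP[/andP[neq_f Ff]|new]; first by apply: old_f (sub_F f Ff) neq_f.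
by apply: new_f; move: new; rewrite !inE -!orbA.
Qed.
End Trees.

Lemma count_flatten (T : eqType) (ss : seq (seq T)) e : uniq (flatten ss) ->
  count (fun s => e \in s) ss = (e \in flatten ss).
Proof.
elim: ss => //= s ss IHss; rewrite cat_uniq mem_cat => /and3P[_ dis /IHss->].
case: (boolP (e \in s)) => // e_s; case: (boolP (e \in _)) => // e_ss.
by case/hasP: dis; exists e.
Qed.

Lemma path_edgesE (G : sgraph) (p : seq G) : path_edges p = links p.
Proof.
rewrite /path_edges /links; case: p => // x p /=.
by elim: p x => //= y p IHp x; rewrite IHp.
Qed.

Theorem theorem2 (G : sgraph) (n : nat) (hn : #|G| = n) (n_gt3 : 3 < n)
    (hG : planar_3tree G) :
  exists P : seq (seq G), path_cover P /\ size P <= (5 * n) %/ 8.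
Proof.
have [E [F [/stacked_tree[a [b [c [t [uniq_t eqV eqE _]]]]] adjE]]] := hG.
have def_n : n = 3 + size (tree_verts t).
  rewrite -hn -[3]/(size [:: a; b; c]) -size_cat -(card_uniqP uniq_t).
  by rewrite (eq_card eqV) cardsT.
have [k [[P /andP[okP decP] leP] le_k]] := tree_bound uniq_t.
have {le_k} le_k : k <= (5 * n) %/ 8.
  move: le_k; rewrite leq_divRL // -def_n -tree_verts_nil.
  have /negPf-> : size (tree_verts t) != 0 by apply: contraTneq n_gt3 => sz0; rewrite def_n sz0.
  by rewrite addn0 mulnC.
have uniqE : uniq (tree_edges a b c t ++ triangle a b c).
  have [uniq_abc out] : uniq [:: a; b; c] /\ {in tree_verts t, forall x, x \notin [:: a; b; c]}.
    by move: uniq_t; rewrite cat_uniq => /and3P[? /hasPn].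
  apply: uniq_tree_edges_cat; [exact: uniq_tree_edges | exact: uniq_triangle |].
  by apply/allP=> x /out; rewrite fresh_triangle.
have linksE e : (e \in flatten [seq links p | p <- P]) = (e \in E).
  by rewrite (perm_mem decP) eqE.
exists P; split; last exact: leq_trans leP le_k.
split=> [|x y adj_xy].
  apply/allP=> p Pp; have /andP[p_nil p_uniq] := allP okP p Pp.
  rewrite /simple_path p_nil p_uniq andbT /=.
  have sub_p : {subset links p <= E}.
    by move=> e e_p; rewrite -linksE; apply/flattenP; exists (links p); rewrite ?map_f.
  case: p sub_p {Pp p_nil p_uniq} => // x p; rewrite /links.
  elim: p x => //= y p IHp x sub_p; rewrite adjE sub_p ?mem_head //=.
  by apply: IHp => e e_p; apply: sub_p; rewrite inE e_p orbT.
rewrite -(eq_count (a1 := preim (@links G) (fun s => [set x; y] \in s))) => [|p]; last first.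
  by rewrite /= path_edgesE.
rewrite -count_map count_flatten; last by rewrite (perm_uniq decP).
by rewrite linksE -adjE adj_xy.
Qed.
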